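(* The Hamiltonian systems on $\mathbb R^{6N}$ (with Poisson bracket $\{\cdot,\cdot\}$) generated by $H^x$, $H^y$, $H^t$ are completely integrable in the Liouville sense: $H^x,H^y,H^t$ pairwise Poisson-commute; the $3N$ functions $E_m^{(k)}$ ($k=1,2,3$; $m=0,\dots,N-1$) Poisson-commute pairwise and with each of $H^x,H^y,H^t$ (hence are integrals of motion of all three systems); and these $3N$ functions are functionally independent on a dense open subset of $\mathbb R^{6N}$. Moreover, if $(\Phi_1,\Phi_2,\Phi_3)(x,y,t)$ is a smooth simultaneous solution of the three Hamiltonian systems $$\mathrm{i}\,\phi_{j\alpha,s}=\frac{\partial H^s}{\partial\bar\phi_{j\alpha}},\quad -\mathrm{i}\,\bar\phi_{j\alpha,s}=\frac{\partial H^s}{\partial\phi_{j\alpha}}\qquad(s\in\{x,y,t\}),$$ then $u=\mathrm{i}\langle\Phi_2,\Phi_1\rangle$, $v_1=2|\langle\Phi_3,\Phi_1\rangle|^2$, $v_2=2|\langle\Phi_3,\Phi_2\rangle|^2$ solve the Davey–Stewartson I equation $$-\mathrm{i}u_t=u_{xx}+u_{yy}+2|u|^2u+2(v_1+v_2)u,\qquad v_{1,x}-v_{1,y}=v_{2,x}+v_{2,y}=-(|u|^2)_x .$$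
   Context: Fix $N\ge1$, distinct nonzero real $\lambda_1,\dots,\lambda_N$, $\Lambda=\operatorname{diag}(\lambda_1,\dots,\lambda_N)$. Phase space $\mathbb C^{3N}\cong\mathbb R^{6N}$ with points $(\Phi_1,\Phi_2,\Phi_3)$, $\Phi_j=(\phi_{j1},\dots,\phi_{jN})^T$, real coordinates $\operatorname{Re}\phi_{j\alpha},\operatorname{Im}\phi_{j\alpha}$, Wirtinger derivatives. $\langle V,W\rangle=V^*W$, so $\langle\Phi_i,\Lambda^m\Phi_j\rangle=\sum_\alpha\lambda_\alpha^m\bar\phi_{i\alpha}\phi_{j\alpha}$; $\Omega_j=\langle\Phi_j,\Phi_j\rangle$. Poisson bracket: $\{\xi,\eta\}=-\mathrm{i}\sum_{j,\alpha}\big(\partial_{\phi_{j\alpha}}\xi\,\partial_{\bar\phi_{j\alpha}}\eta-\partial_{\bar\phi_{j\alpha}}\xi\,\partial_{\phi_{j\alpha}}\eta\big)$ (from $\omega=\mathrm{i}\sum d\bar\phi_{j\alpha}\wedge d\phi_{j\alpha}$). $L(\lambda)=C+\sum_\alpha(\lambda-\lambda_\alpha)^{-1}F_\alpha F_\alpha^*$ with $C=\operatorname{diag}(1,-1,0)$, $F_\alpha=(\phi_{1\alpha},\phi_{2\alpha},\phi_{3\alpha})^T$. Define $p_k$ by $\det(\xi I-L(\lambda))=\xi^3-p_1(\lambda)\xi^2+p_2(\lambda)\xi-p_3(\lambda)$ and $E_m^{(k)}$ by $p_k(\lambda)=\sum_{m=-1}^\infty E_m^{(k)}\lambda^{-m-1}$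 for $|\lambda|>\max_\alpha|\lambda_\alpha|$. Hamiltonians: $H^x=-\langle\Phi_1,\Lambda\Phi_1\rangle-\langle\Phi_2,\Lambda\Phi_2\rangle-|\langle\Phi_1,\Phi_3\rangle|^2+|\langle\Phi_2,\Phi_3\rangle|^2$; $H^y=-\langle\Phi_1,\Lambda\Phi_1\rangle+\langle\Phi_2,\Lambda\Phi_2\rangle-|\langle\Phi_1,\Phi_3\rangle|^2-|\langle\Phi_2,\Phi_3\rangle|^2-|\langle\Phi_1,\Phi_2\rangle|^2$; $H^t=2\langle\Phi_1,\Lambda^2\Phi_1\rangle-2\langle\Phi_2,\Lambda^2\Phi_2\rangle+4\operatorname{Re}(\langle\Phi_1,\Phi_3\rangle\langle\Phi_3,\Lambda\Phi_1\rangle)+4\operatorname{Re}(\langle\Phi_2,\Phi_3\rangle\langle\Phi_3,\Lambda\Phi_2\rangle)+4\operatorname{Re}(\langle\Phi_1,\Phi_2\rangle\langle\Phi_2,\Lambda\Phi_1\rangle)+2(\Omega_3-\Omega_1)|\langle\Phi_1,\Phi_3\rangle|^2-2(\Omega_3-\Omega_2)|\langle\Phi_2,\Phi_3\rangle|^2-(\Omega_1-\Omega_2)|\langle\Phi_1,\Phi_2\rangle|^2$. Functional independence means: on a dense open subset of $\mathbb R^{6N}$ the Jacobian of the $3N$ functions with respect to the $6N$ real coordinates has rank $3N$. *)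

(* Defs.v *)
From HB Require Import structures.
From mathcomp Require Import all_boot all_order all_algebra.
From mathcomp Require Import all_classical all_reals all_analysis.
From mathcomp Require Import complex.
Import Order.TTheory GRing.Theory Num.Theory.
Import numFieldTopology.Exports numFieldNormedType.Exports.

Set Implicit Arguments.
Unset Strict Implicit.
Unset Printing Implicit Defensive.

Local Open Scope ring_scope.
Local Open Scope classical_set_scope.

Definition reC {R : rcfType} (z : R[i]) : R := let: Complex a _ := z in a.
Definition imC {R : rcfType} (z : R[i]) : R := let: Complex _ b := z in b.
Definition ofR {R : rcfType} (a : R) : R[i] := Complex a 0.
Definition iC {R : rcfType} : R[i] := Complex 0 1.
Definition absq {R : rcfType} (z : R[i]) : R := reC z ^+ 2 + imC z ^+ 2.

(* Phase space  C^{3N} = R^{6N}, N = n.+1.                              *)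
(* A point x : 'M[R]_(6, N); row  j  (j < 3) holds Re phi_{j+1,alpha},   *)
(* row 3 + j holds Im phi_{j+1,alpha}.                                 *)
Definition PS (R : realType) (n : nat) := 'M[R]_(6, n.+1).

Definition reI (j : 'I_3) : 'I_6 := @lshift 3 3 j.
Definition imI (j : 'I_3) : 'I_6 := @rshift 3 3 j.

Definition phi {R : realType} {n : nat} (x : PS R n) (j : 'I_3) (a : 'I_n.+1)
  : R[i] := Complex (x (reI j) a) (x (imI j) a).

Definition cD {R : realType} {V : normedModType R} (v : V) (f : V -> R[i])
  (x : V) : R[i] :=
  Complex ('D_v (fun y => reC (f y)) x) ('D_v (fun y => imC (f y)) x).

Definition dRe {R : realType} {n : nat} (f : PS R n -> R[i]) j a (x : PS R n) :=
  cD (delta_mx (reI j) a : PS R n) f x.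
Definition dIm {R : realType} {n : nat} (f : PS R n -> R[i]) j a (x : PS R n) :=
  cD (delta_mx (imI j) a : PS R n) f x.

Definition dphi {R : realType} {n : nat} (f : PS R n -> R[i]) j a x : R[i] :=
  (dRe f j a x - iC * dIm f j a x) / 2.
Definition dphibar {R : realType} {n : nat} (f : PS R n -> R[i]) j a x : R[i] :=
  (dRe f j a x + iC * dIm f j a x) / 2.

Definition pb {R : realType} {n : nat} (xi eta : PS R n -> R[i]) (x : PS R n)
  : R[i] :=
  - iC * \sum_(j < 3) \sum_(a < n.+1)
      (dphi xi j a x * dphibar eta j a x - dphibar xi j a x * dphi eta j a x).

Definition poisson_commute {R : realType} {n : nat} (f g : PS R n -> R[i]) :=
  forall x, pb f g x = 0.

Definition ip {R : realType} {n : nat} (lam : 'I_n.+1 -> R) (m : nat)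
  (i j : 'I_3) (x : PS R n) : R[i] :=
  \sum_(a < n.+1) ofR (lam a ^+ m) * conjc (phi x i a) * phi x j a.

Definition Omega {R : realType} {n : nat} (lam : 'I_n.+1 -> R) (j : 'I_3) x :=
  ip lam 0 j j x.

(* indices: Phi_1 ~ 0, Phi_2 ~ 1, Phi_3 ~ 2 *)
Definition i0 : 'I_3 := @Ordinal 3 0 isT.
Definition i1 : 'I_3 := @Ordinal 3 1 isT.
Definition i2 : 'I_3 := @Ordinal 3 2 isT.

Definition Hx {R : realType} {n : nat} (lam : 'I_n.+1 -> R) (x : PS R n) : R[i] :=
  - ip lam 1 i0 i0 x - ip lam 1 i1 i1 x
  - ofR (absq (ip lam 0 i0 i2 x)) + ofR (absq (ip lam 0 i1 i2 x)).

Definition Hy {R : realType} {n : nat} (lam : 'I_n.+1 -> R) (x : PS R n) : R[i] :=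
  - ip lam 1 i0 i0 x + ip lam 1 i1 i1 x
  - ofR (absq (ip lam 0 i0 i2 x)) - ofR (absq (ip lam 0 i1 i2 x))
  - ofR (absq (ip lam 0 i0 i1 x)).

Definition Ht {R : realType} {n : nat} (lam : 'I_n.+1 -> R) (x : PS R n) : R[i] :=
  2 * ip lam 2 i0 i0 x - 2 * ip lam 2 i1 i1 x
  + ofR (4 * reC (ip lam 0 i0 i2 x * ip lam 1 i2 i0 x))
  + ofR (4 * reC (ip lam 0 i1 i2 x * ip lam 1 i2 i1 x))
  + ofR (4 * reC (ip lam 0 i0 i1 x * ip lam 1 i1 i0 x))
  + 2 * (Omega lam i2 x - Omega lam i0 x) * ofR (absq (ip lam 0 i0 i2 x))
  - 2 * (Omega lam i2 x - Omega lam i1 x) * ofR (absq (ip lam 0 i1 i2 x))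
  - (Omega lam i0 x - Omega lam i1 x) * ofR (absq (ip lam 0 i0 i1 x)).

Definition Cmat {R : rcfType} : 'M[R[i]]_3 :=
  \matrix_(i < 3, j < 3)
     (if i == j then (if i == i0 then 1 else if i == i1 then -1 else 0) else 0).

Definition FF {R : realType} {n : nat} (x : PS R n) (a : 'I_n.+1) : 'M[R[i]]_3 :=
  \matrix_(i < 3, j < 3) (phi x i a * conjc (phi x j a)).

(* L(lambda) written in the variable z = 1/lambda, with each
   (lambda - lam_a)^{-1} = sum_{k>=0} lam_a^k z^{k+1} truncated to k < M:
   a 3x3 matrix of polynomials in z. *)
Definition Ltrunc {R : realType} {n : nat} (lam : 'I_n.+1 -> R) (M : nat)
  (x : PS R n) : 'M[{poly R[i]}]_3 :=
  map_mx polyC Cmat +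
  \sum_(a < n.+1) \sum_(k < M)
     ('X^(k.+1) * (ofR (lam a ^+ k))%:P) *: map_mx polyC (FF x a).

(* p_kk(lambda) (kk = 1,2,3) as a polynomial in z = 1/lambda, from
   det(xi I - L) = xi^3 - p1 xi^2 + p2 xi - p3, char_poly A = det('X I - A). *)
Definition pk {R : realType} {n : nat} (lam : 'I_n.+1 -> R) (M kk : nat)
  (x : PS R n) : {poly R[i]} :=
  (-1) ^+ kk * (char_poly (Ltrunc lam M x))`_(3 - kk).

(* E_m^{(k.+1)} = coefficient of lambda^{-m-1} = z^{m+1} in the expansion of
   p_{k+1} at lambda = infinity; truncation at order M = m+1 is exact for
   this coefficient. *)
Definition E {R : realType} {n : nat} (lam : 'I_n.+1 -> R) (k : 'I_3) (m : nat)
  (x : PS R n) : R[i] :=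
  (pk lam m.+1 k.+1 x)`_m.+1.

Definition Jac {R : realType} {n : nat} (lam : 'I_n.+1 -> R) (x : PS R n)
  : 'M[R[i]]_(3 * n.+1, 6 * n.+1) :=
  \matrix_(r < 3 * n.+1)
     mxvec (\matrix_(c < 6, a < n.+1)
       cD (delta_mx c a : PS R n) (E lam (inord (r %/ n.+1)) (r %% n.+1)) x).

(* coordinate directions of R^3 = (x, y, t) *)
Definition ed {R : realType} (s : 'I_3) : 'rV[R]_3 := delta_mx 0 s.

Definition Hs {R : realType} {n : nat} (lam : 'I_n.+1 -> R) (s : 'I_3)
  : PS R n -> R[i] :=
  if s == i0 then Hx lam else if s == i1 then Hy lam else Ht lam.

Definition iterD {R : realType} {W : normedModType R} (l : seq 'I_3)
  (f : 'rV[R]_3 -> W) : 'rV[R]_3 -> W :=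
  foldr (fun s g => fun p => 'D_(ed s) g p) f l.

Definition smooth3 {R : realType} {W : normedModType R} (D : set 'rV[R]_3)
  (f : 'rV[R]_3 -> W) :=
  forall (l : seq 'I_3) (p : 'rV[R]_3), D p -> differentiable (iterD l f) p.

Definition phi_s {R : realType} {n : nat} (sol : 'rV[R]_3 -> PS R n) (s : 'I_3)
  (j : 'I_3) (a : 'I_n.+1) (p : 'rV[R]_3) : R[i] :=
  Complex (('D_(ed s) sol p) (reI j) a) (('D_(ed s) sol p) (imI j) a).

Definition ham_solution {R : realType} {n : nat} (lam : 'I_n.+1 -> R)
  (D : set 'rV[R]_3) (sol : 'rV[R]_3 -> PS R n) :=
  forall (s j : 'I_3) (a : 'I_n.+1) (p : 'rV[R]_3), D p ->
    iC * phi_s sol s j a p = dphibar (Hs lam s) j a (sol p) /\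
    - iC * conjc (phi_s sol s j a p) = dphi (Hs lam s) j a (sol p).

Definition DSI {R : realType} (D : set 'rV[R]_3)
  (u : 'rV[R]_3 -> R[i]) (v1 v2 : 'rV[R]_3 -> R) :=
  forall p : 'rV[R]_3, D p ->
    - iC * cD (ed i2) u p =
      cD (ed i0) (cD (ed i0) u) p + cD (ed i1) (cD (ed i1) u) p
      + 2 * ofR (absq (u p)) * u p + 2 * ofR (v1 p + v2 p) * u p
  /\ 'D_(ed i0) v1 p - 'D_(ed i1) v1 p = - 'D_(ed i0) (fun q => absq (u q)) p
  /\ 'D_(ed i0) v2 p + 'D_(ed i1) v2 p = - 'D_(ed i0) (fun q => absq (u q)) p.

(* Main.v *)
(** The bracket of two weighted moments [sum_a w_a conj(phi_ia) phi_ja] is again such a moment, with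
weight the product of the weights.  Hence the entries of [L(t)] and [L(s)], at real points
[t <> s] off the spectrum, satisfy the r-matrix relation
[{L_ij(t), L'_kl(s)} = c (delta_il (L - L')_kj - delta_jk (L - L')_il)], [c = -i / (s - t)], and the
coefficients of the characteristic polynomials of [L(t)] and [L(s)] commute.  After multiplication
by powers of [prod_a (1 - lam_a z)], [z = 1 / t], these coefficients become polynomials in [z] of
bounded degree, so by Lagrange interpolation every [E_m^(k)] is a fixed linear combination of their
values at finitely many points; this transfers the commutation to the [E_m^(k)].  The brackets
with the Hamiltonians, and the Davey-Stewartson equation, become polynomial identities in
the moments [<Phi_i, Lam^m Phi_j>].

For independence, near the origin [E_m^(k)] is a combination of the [<Phi_j, Lam^m Phi_j>] up to
fourth order, so on the ray through the all-ones point the minor of the Jacobian given by the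
derivatives in the real parts is, to leading order, an invertible 3x3 matrix tensor a Vandermonde
matrix.  A polynomial that is not identically zero is nonzero on a dense open set. *)

Require Import Defs.
From HB Require Import structures.
From mathcomp Require Import all_boot all_order all_algebra.
From mathcomp Require Import all_classical all_reals all_analysis.
From mathcomp Require Import complex ring qpoly.
Import Order.TTheory GRing.Theory Num.Theory.
Import numFieldTopology.Exports numFieldNormedType.Exports.

Set Implicit Arguments.
Unset Strict Implicit.
Unset Printing Implicit Defensive.

Local Open Scope ring_scope.
Local Open Scope classical_set_scope.

(** * Directional derivatives of complex-valued functions *)

Section ComplexParts.
Context {R : rcfType}.
Implicit Types (z w : R[i]) (a b : R).

Lemma reCD z w : reC (z + w) = reC z + reC w.
Proof. by case: z => ? ?; case: w. Qed.

Lemma imCD z w : imC (z + w) = imC z + imC w.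
Proof. by case: z => ? ?; case: w. Qed.

Lemma reCM z w : reC (z * w) = reC z * reC w - imC z * imC w.
Proof. by case: z => ? ?; case: w. Qed.

Lemma imCM z w : imC (z * w) = reC z * imC w + imC z * reC w.
Proof. by case: z => ? ?; case: w => ? ?. Qed.

Lemma ofRD a b : ofR (a + b) = ofR a + ofR b.
Proof. by apply/eqP; rewrite eq_complex /= addr0 !eqxx. Qed.

Lemma ofRM a b : ofR (a * b) = ofR a * ofR b.
Proof. by apply/eqP; rewrite eq_complex /= !(mulr0, mul0r) subr0 addr0 !eqxx. Qed.

Lemma ofRN a : ofR (- a) = - ofR a.
Proof. by apply/eqP; rewrite eq_complex /= oppr0 !eqxx. Qed.

Lemma ofRB a b : ofR (a - b) = ofR a - ofR b.
Proof. by rewrite ofRD ofRN. Qed.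

Lemma ofR_nat k : @ofR R k%:R = k%:R.
Proof. by elim: k => [//|k IH]; rewrite !mulrS ofRD IH. Qed.

Lemma ofRX a k : ofR (a ^+ k) = ofR a ^+ k.
Proof. by elim: k => [//|k IH]; rewrite !exprS ofRM IH. Qed.

Lemma ofR_inj : injective (@ofR R).
Proof. by move=> a b []. Qed.

Lemma ofR_eq0 a : (ofR a == 0) = (a == 0).
Proof. by rewrite -(inj_eq ofR_inj). Qed.

Lemma ofRV a : ofR a^-1 = (ofR a)^-1.
Proof.
have [->|a0] := eqVneq a 0; first by rewrite invr0 [ofR 0](_ : _ = 0) ?invr0.
apply: (mulfI (x := ofR a)); first by rewrite ofR_eq0.
by rewrite -ofRM !divff // ofR_eq0.
Qed.

Lemma iC_sqr : @iC R * iC = -1.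
Proof. by apply/eqP; rewrite eq_complex /= !(mulr0, mul0r, mulr1) sub0r addr0 oppr0 !eqxx. Qed.

Lemma Complex_iC a b : Complex a b = ofR a + iC * ofR b.
Proof.
by apply/eqP; rewrite eq_complex /= !(mulr0, mul0r, mul1r) !(addr0, add0r, subr0) !eqxx.
Qed.

Lemma absqE z : ofR (absq z) = z * conjc z.
Proof.
case: z => a b; apply/eqP; rewrite eq_complex /absq /= -!expr2 mulrN -expr2 opprK eqxx /=.
by rewrite mulrN [b * a]mulrC addNr.
Qed.

Lemma reCE z : ofR (2 * reC z) = z + conjc z.
Proof.
case: z => a b; apply/eqP; rewrite eq_complex /= subrr eqxx andbT.
by rewrite mulr_natl mulr2n.
Qed.

Lemma conjcD z w : conjc (z + w) = conjc z + conjc w.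
Proof. exact: raddfD. Qed.

Lemma conjcM z w : conjc (z * w) = conjc z * conjc w.
Proof. exact: rmorphM. Qed.

Lemma conjc_ofR a : conjc (ofR a) = ofR a.
Proof. by congr Complex; exact: oppr0. Qed.

End ComplexParts.

Section DirectionalDerivative.
Context {R : realType} {V : normedModType R}.
Implicit Types (f g : V -> R[i]) (x v : V).

(** Real differentiability of both components, matching the componentwise [cD]; holomorphy is not
    meant, since conjugates must qualify. *)
Definition cdifferentiable f x :=
  differentiable (fun y => reC (f y)) x /\ differentiable (fun y => imC (f y)) x.

Lemma cdifferentiable_cst (c : R[i]) x : cdifferentiable (fun=> c) x.
Proof. by split; apply: differentiable_cst. Qed.

Lemma cdifferentiableD f g x : cdifferentiable f x -> cdifferentiable g x ->
  cdifferentiable (fun y => f y + g y) x.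
Proof.
move=> [f1 f2] [g1 g2]; split.
  rewrite (_ : (fun _ => _) = (reC \o f) + (reC \o g)) ?funeqE; last first.
    by move=> y /=; rewrite reCD.
  exact: differentiableD.
rewrite (_ : (fun _ => _) = (imC \o f) + (imC \o g)) ?funeqE; last first.
  by move=> y /=; rewrite imCD.
exact: differentiableD.
Qed.

Lemma cdifferentiableM f g x : cdifferentiable f x -> cdifferentiable g x ->
  cdifferentiable (fun y => f y * g y) x.
Proof.
move=> [f1 f2] [g1 g2]; split.
  rewrite (_ : (fun _ => _) = (reC \o f) * (reC \o g) - (imC \o f) * (imC \o g)).
    by apply: differentiableB; apply: differentiableM.
  by rewrite funeqE => y /=; rewrite reCM.
rewrite (_ : (fun _ => _) = (reC \o f) * (imC \o g) + (imC \o f) * (reC \o g)).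
  by apply: differentiableD; apply: differentiableM.
by rewrite funeqE => y /=; rewrite imCM.
Qed.

Lemma cD_cst (c : R[i]) v x : cD v (fun=> c) x = 0.
Proof. by rewrite /cD !derive_cst. Qed.

Lemma cDD f g v x : cdifferentiable f x -> cdifferentiable g x ->
  cD v (fun y => f y + g y) x = cD v f x + cD v g x.
Proof.
move=> [f1 f2] [g1 g2]; rewrite /cD.
rewrite (_ : (fun y => reC (f y + g y)) = (reC \o f) + (reC \o g)) ?funeqE; last first.
  by move=> y /=; rewrite reCD.
rewrite (_ : (fun y => imC (f y + g y)) = (imC \o f) + (imC \o g)) ?funeqE; last first.
  by move=> y /=; rewrite imCD.
by rewrite !deriveD //; apply: diff_derivable.
Qed.

Lemma cDM f g v x : cdifferentiable f x -> cdifferentiable g x ->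
  cD v (fun y => f y * g y) x = cD v f x * g x + f x * cD v g x.
Proof.
move=> [/diff_derivable f1 /diff_derivable f2] [/diff_derivable g1 /diff_derivable g2].
rewrite /cD.
rewrite (_ : (fun y => reC (f y * g y)) =
    (reC \o f) * (reC \o g) - (imC \o f) * (imC \o g)) ?funeqE; last first.
  by move=> y /=; rewrite reCM.
rewrite (_ : (fun y => imC (f y * g y)) =
    (reC \o f) * (imC \o g) + (imC \o f) * (reC \o g)) ?funeqE; last first.
  by move=> y /=; rewrite imCM.
rewrite (deriveB (derivableM (f1 v) (g1 v)) (derivableM (f2 v) (g2 v))).
rewrite (deriveD (derivableM (f1 v) (g2 v)) (derivableM (f2 v) (g1 v))).
rewrite (deriveM (f1 v) (g1 v)) (deriveM (f2 v) (g2 v)).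
rewrite (deriveM (f1 v) (g2 v)) (deriveM (f2 v) (g1 v)).
rewrite /GRing.scale /=; case: (f x) => a b; case: (g x) => c d /=.
move: ('D_v _ x) ('D_v _ x) ('D_v _ x) ('D_v _ x) => a' b' c' d'.
by congr Complex; ring.
Qed.

Lemma cD_ofR (f : V -> R) v x : cD v (fun y => ofR (f y)) x = ofR ('D_v f x).
Proof. by rewrite /cD derive_cst. Qed.

Lemma near_eq_cD f g v x : (\near x, f x = g x) -> cD v f x = cD v g x.
Proof.
by move=> fg; congr Complex; apply: near_eq_derive; apply: filterS fg => y ->.
Qed.

End DirectionalDerivative.

(** * Polynomial functions on the phase space and their Poisson brackets *)

Section PolynomialFunctions.
Context {R : realType} {n : nat}.
Implicit Types (f g h : PS R n -> R[i]) (x v : PS R n).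

(** Polynomials in the coordinates and their conjugates. The inductive form lets differentiability,
    the evolution along a flow and restriction to lines be proved by induction from the
    generators. *)
Inductive polyfun : (PS R n -> R[i]) -> Prop :=
| polyfun_cst c : polyfun (fun=> c)
| polyfun_phi j a : polyfun (fun x => phi x j a)
| polyfun_conj j a : polyfun (fun x => conjc (phi x j a))
| polyfunD f g : polyfun f -> polyfun g -> polyfun (fun x => f x + g x)
| polyfunM f g : polyfun f -> polyfun g -> polyfun (fun x => f x * g x).

Lemma polyfun_sum I (r : seq I) (P : pred I) (F : I -> PS R n -> R[i]) :
  (forall i, polyfun (F i)) -> polyfun (fun x => \sum_(i <- r | P i) F i x).
Proof.
move=> pF; rewrite (_ : (fun _ => _) = \big[(fun f g x => f x + g x)/(fun=> 0)]_(i <- r | P i) F i).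
  by apply: big_ind => //; [exact: polyfun_cst | exact: polyfunD].
rewrite funeqE => x; elim: r => [|i r IH]; first by rewrite !big_nil.
by rewrite !big_cons; case: ifP => _; rewrite IH.
Qed.

Lemma polyfun_prod I (r : seq I) (P : pred I) (F : I -> PS R n -> R[i]) :
  (forall i, polyfun (F i)) -> polyfun (fun x => \prod_(i <- r | P i) F i x).
Proof.
move=> pF; rewrite (_ : (fun _ => _) = \big[(fun f g x => f x * g x)/(fun=> 1)]_(i <- r | P i) F i).
  by apply: big_ind => //; [exact: polyfun_cst | exact: polyfunM].
rewrite funeqE => x; elim: r => [|i r IH]; first by rewrite !big_nil.
by rewrite !big_cons; case: ifP => _; rewrite IH.
Qed.

Section Composition.
Context {V : normedModType R} (sol : V -> PS R n) (p : V).
Hypothesis dsol : differentiable sol p.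

Lemma differentiable_entry i a : differentiable (fun q => sol q i a) p.
Proof.
exact: (@differentiable_comp _ _ _ _ sol (fun M : PS R n => M i a) p dsol
  (differentiable_coord _ _ _)).
Qed.

Lemma cdifferentiable_phi j a : cdifferentiable (fun q => phi (sol q) j a) p.
Proof. by split; apply: differentiable_entry. Qed.

Lemma cdifferentiable_conj j a : cdifferentiable (fun q => conjc (phi (sol q) j a)) p.
Proof.
split; first exact: (differentiable_entry (reI j) a).
exact: (differentiableN (differentiable_entry (imI j) a)).
Qed.

(** Stated along a map [sol]: the identity gives derivatives on the phase space, a solution of the
    flows gives derivatives in x, y, t. *)
Lemma polyfun_cdifferentiable f : polyfun f -> cdifferentiable (fun q => f (sol q)) p.
Proof.
elim=> [c|j a|j a|{}f g _ df _ dg|{}f g _ df _ dg].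
- exact: cdifferentiable_cst.
- exact: cdifferentiable_phi.
- exact: cdifferentiable_conj.
- exact: cdifferentiableD.
- exact: cdifferentiableM.
Qed.

Lemma derive_entry e i a : 'D_e (fun q => sol q i a) p = ('D_e sol p) i a.
Proof. by rewrite derive_mx ?mxE //; apply: diff_derivable. Qed.

Lemma cD_phi e j a : cD e (fun q => phi (sol q) j a) p =
  Complex (('D_e sol p) (reI j) a) (('D_e sol p) (imI j) a).
Proof. by rewrite /cD /= !derive_entry. Qed.

Lemma cD_conj e j a : cD e (fun q => conjc (phi (sol q) j a)) p =
  conjc (cD e (fun q => phi (sol q) j a) p).
Proof.
rewrite cD_phi /cD /= derive_entry; congr Complex.
rewrite -derive_entry -deriveN //; apply/diff_derivable/differentiable_entry.
Qed.

End Composition.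

Lemma cdiff f x : polyfun f -> cdifferentiable f x.
Proof. by move=> pf; apply: (polyfun_cdifferentiable (sol := id)). Qed.

Lemma cD_phi_id v j a x : cD v (fun y => phi y j a) x = Complex (v (reI j) a) (v (imI j) a).
Proof. by rewrite (cD_phi (sol := id)) // derive_id. Qed.

Lemma cD_conj_id v j a x :
  cD v (fun y => conjc (phi y j a)) x = conjc (Complex (v (reI j) a) (v (imI j) a)).
Proof. by rewrite (cD_conj (sol := id)) // cD_phi_id. Qed.

(** Makes the entries of the Jacobian, hence its minors, polynomial. *)
Lemma polyfun_cD v f : polyfun f -> polyfun (cD v f).
Proof.
elim=> [c|j a|j a|{}f g pf IHf pg IHg|{}f g pf IHf pg IHg].
- rewrite (_ : cD _ _ = fun=> 0); first exact: polyfun_cst.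
  by rewrite funeqE => x; rewrite cD_cst.
- rewrite (_ : cD _ _ = fun=> Complex (v (reI j) a) (v (imI j) a)); first exact: polyfun_cst.
  by rewrite funeqE => x; rewrite cD_phi_id.
- rewrite (_ : cD _ _ = fun=> conjc (Complex (v (reI j) a) (v (imI j) a))).
    exact: polyfun_cst.
  by rewrite funeqE => x; rewrite cD_conj_id.
- rewrite (_ : cD _ _ = fun x => cD v f x + cD v g x); first exact: polyfunD.
  by rewrite funeqE => x; rewrite cDD //; exact: cdiff.
- rewrite (_ : cD _ _ = fun x => cD v f x * g x + f x * cD v g x).
    by apply: polyfunD; apply: polyfunM.
  by rewrite funeqE => x; rewrite cDM //; exact: cdiff.
Qed.

Lemma dphiD f g j a x : polyfun f -> polyfun g ->
  dphi (fun y => f y + g y) j a x = dphi f j a x + dphi g j a x.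
Proof.
move=> pf pg; rewrite /dphi /dRe /dIm !cDD; try exact: cdiff.
by rewrite -mulrDl mulrDr opprD addrACA.
Qed.

Lemma dphibarD f g j a x : polyfun f -> polyfun g ->
  dphibar (fun y => f y + g y) j a x = dphibar f j a x + dphibar g j a x.
Proof.
move=> pf pg; rewrite /dphibar /dRe /dIm !cDD; try exact: cdiff.
by rewrite -mulrDl mulrDr addrACA.
Qed.

Lemma dphiM f g j a x : polyfun f -> polyfun g ->
  dphi (fun y => f y * g y) j a x = dphi f j a x * g x + f x * dphi g j a x.
Proof.
move=> pf pg; rewrite /dphi /dRe /dIm !cDM; try exact: cdiff.
by move: (cD _ f x) (cD _ f x) (cD _ g x) (cD _ g x) => a1 a2 b1 b2; ring.
Qed.

Lemma dphibarM f g j a x : polyfun f -> polyfun g ->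
  dphibar (fun y => f y * g y) j a x = dphibar f j a x * g x + f x * dphibar g j a x.
Proof.
move=> pf pg; rewrite /dphibar /dRe /dIm !cDM; try exact: cdiff.
by move: (cD _ f x) (cD _ f x) (cD _ g x) (cD _ g x) => a1 a2 b1 b2; ring.
Qed.

Lemma dphi_cst c j a x : dphi (fun=> c) j a x = 0.
Proof. by rewrite /dphi /dRe /dIm !cD_cst mulr0 subr0 mul0r. Qed.

Lemma dphibar_cst c j a x : dphibar (fun=> c) j a x = 0.
Proof. by rewrite /dphibar /dRe /dIm !cD_cst mulr0 addr0 mul0r. Qed.

Lemma eq_reI j k : (reI j == reI k) = (j == k).
Proof. exact: (inj_eq (@lshift_inj 3 3)). Qed.

Lemma eq_imI j k : (imI j == imI k) = (j == k).
Proof. exact: (inj_eq (@rshift_inj 3 3)). Qed.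

Lemma eq_reI_imI j k : (reI j == imI k) = false.
Proof. exact: eq_lrshift. Qed.

Lemma eq_imI_reI j k : (imI j == reI k) = false.
Proof. by rewrite eq_sym eq_reI_imI. Qed.

Lemma halfD (c : R[i]) : (c + c) / 2 = c.
Proof. by rewrite -[c + c](mulr_natr c 2) mulfK // pnatr_eq0. Qed.

Lemma dRe_phi j a k b x : dRe (fun y => phi y j a) k b x = ((j == k) && (a == b))%:R.
Proof.
rewrite /dRe cD_phi_id !mxE eq_reI eq_imI_reI /=.
exact: ofR_nat.
Qed.

Lemma dIm_phi j a k b x : dIm (fun y => phi y j a) k b x = iC * ((j == k) && (a == b))%:R.
Proof.
rewrite /dIm cD_phi_id !mxE eq_imI eq_reI_imI /= Complex_iC !ofR_nat.
by rewrite mulr0n add0r.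
Qed.

Lemma dRe_conj j a k b x :
  dRe (fun y => conjc (phi y j a)) k b x = ((j == k) && (a == b))%:R.
Proof.
rewrite /dRe cD_conj_id !mxE eq_reI eq_imI_reI /= oppr0.
exact: ofR_nat.
Qed.

Lemma dIm_conj j a k b x :
  dIm (fun y => conjc (phi y j a)) k b x = - iC * ((j == k) && (a == b))%:R.
Proof.
rewrite /dIm cD_conj_id !mxE eq_imI eq_reI_imI /= Complex_iC ofRN !ofR_nat.
by rewrite mulr0n add0r mulrN mulNr.
Qed.

(** With the next three lemmas: for the Wirtinger derivatives, the coordinates and their conjugates
    are independent variables. *)
Lemma dphi_phi j a k b x : dphi (fun y => phi y j a) k b x = ((j == k) && (a == b))%:R.
Proof.
by rewrite /dphi dRe_phi dIm_phi mulrA iC_sqr mulN1r opprK halfD.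
Qed.

Lemma dphibar_phi j a k b x : dphibar (fun y => phi y j a) k b x = 0.
Proof. by rewrite /dphibar dRe_phi dIm_phi mulrA iC_sqr mulN1r subrr mul0r. Qed.

Lemma dphi_conj j a k b x : dphi (fun y => conjc (phi y j a)) k b x = 0.
Proof. by rewrite /dphi dRe_conj dIm_conj mulrA mulrN iC_sqr opprK mul1r subrr mul0r. Qed.

Lemma dphibar_conj j a k b x :
  dphibar (fun y => conjc (phi y j a)) k b x = ((j == k) && (a == b))%:R.
Proof.
by rewrite /dphibar dRe_conj dIm_conj mulrA mulrN iC_sqr opprK mul1r halfD.
Qed.

Lemma pbC f g x : pb f g x = - pb g f x.
Proof.
rewrite /pb -mulrN -sumrN; congr (_ * _); apply: eq_bigr => j _.
by rewrite -sumrN; apply: eq_bigr => a _; rewrite opprB mulrC [X in _ - X]mulrC.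
Qed.

Lemma pbDl f g h x : polyfun f -> polyfun g ->
  pb (fun y => f y + g y) h x = pb f h x + pb g h x.
Proof.
move=> pf pg; rewrite /pb -mulrDr -big_split; congr (_ * _); apply: eq_bigr => j _.
rewrite -big_split; apply: eq_bigr => a _; rewrite dphiD // dphibarD //=.
by rewrite !mulrDl opprD addrACA.
Qed.

Lemma pbMl f g h x : polyfun f -> polyfun g ->
  pb (fun y => f y * g y) h x = pb f h x * g x + f x * pb g h x.
Proof.
move=> pf pg; rewrite /pb !mulrA [_ * - iC]mulrC -!mulrA -mulrDr; congr (_ * _).
rewrite mulr_suml mulr_sumr -big_split; apply: eq_bigr => j _.
rewrite mulr_suml mulr_sumr -big_split; apply: eq_bigr => a _; rewrite dphiM // dphibarM //=.
move: (dphi f j a x) (dphi g j a x) (dphi h j a x) (f x) (g x).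
move: (dphibar f j a x) (dphibar g j a x) (dphibar h j a x) => a1 a2 a3 a4 a5 a6 a7 a8.
ring.
Qed.

Lemma pb_cstl c h x : pb (fun=> c) h x = 0.
Proof.
rewrite /pb big1 ?mulr0 // => j _; rewrite big1 // => a _.
by rewrite dphi_cst dphibar_cst !mul0r subrr.
Qed.

Lemma pbDr f g h x : polyfun f -> polyfun g ->
  pb h (fun y => f y + g y) x = pb h f x + pb h g x.
Proof. by move=> pf pg; rewrite pbC pbDl // [pb h f x]pbC [pb h g x]pbC opprD. Qed.

Lemma pbMr f g h x : polyfun f -> polyfun g ->
  pb h (fun y => f y * g y) x = pb h f x * g x + f x * pb h g x.
Proof. by move=> pf pg; rewrite pbC pbMl // [pb h f x]pbC [pb h g x]pbC opprD mulNr mulrN. Qed.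

Lemma pb_cstr c h x : pb h (fun=> c) x = 0.
Proof. by rewrite pbC pb_cstl oppr0. Qed.

Lemma pb_suml (I : Type) (r : seq I) (c : I -> R[i]) (F : I -> PS R n -> R[i]) g x :
  (forall i, polyfun (F i)) ->
  pb (fun y => \sum_(i <- r) c i * F i y) g x = \sum_(i <- r) c i * pb (F i) g x.
Proof.
move=> pF; elim: r => [|i r IH].
  rewrite big_nil (_ : (fun _ => _) = fun=> 0) ?pb_cstl //.
  by rewrite funeqE => y; rewrite big_nil.
rewrite (_ : (fun _ => _) = fun y => c i * F i y + \sum_(i <- r) c i * F i y).
  have pc j : polyfun (fun y => c j * F j y) by apply: polyfunM => //; exact: polyfun_cst.
  rewrite pbDl ?IH //; last exact: polyfun_sum.
  by rewrite pbMl ?pb_cstl ?mul0r ?add0r ?big_cons //; exact: polyfun_cst.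
by rewrite funeqE => y; rewrite big_cons.
Qed.

Lemma pb_sumr (I : Type) (r : seq I) (c : I -> R[i]) (F : I -> PS R n -> R[i]) g x :
  (forall i, polyfun (F i)) ->
  pb g (fun y => \sum_(i <- r) c i * F i y) x = \sum_(i <- r) c i * pb g (F i) x.
Proof.
move=> pF; rewrite pbC pb_suml // -sumrN; apply: eq_bigr => i _.
by rewrite [pb g _ _]pbC mulrN.
Qed.

End PolynomialFunctions.

(** * Brackets of moments *)

Section Brackets.
Context {R : realType} {n : nat}.
Implicit Types (f g h : PS R n -> R[i]) (x : PS R n) (w : 'I_n.+1 -> R[i]).

(** Only the summand at [(j, a)] survives. Together with [pb_conj], this rewrites Hamilton's
    equations as brackets with the coordinates. *)
Lemma pb_phi j a h x : pb (fun y => phi y j a) h x = - iC * dphibar h j a x.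
Proof.
rewrite /pb (bigD1 j) //= [X in _ + X]big1 ?addr0; last first.
  move=> k kj; rewrite big1 // => b _.
  by rewrite dphi_phi dphibar_phi eq_sym (negbTE kj) !mul0r subrr.
rewrite (bigD1 a) //= [X in _ + X]big1 ?addr0; last first.
  move=> b ba; rewrite dphi_phi dphibar_phi [a == b]eq_sym (negbTE ba) andbF.
  by rewrite !mul0r subrr.
by rewrite dphi_phi dphibar_phi !eqxx mul1r mul0r subr0.
Qed.

Lemma pb_conj j a h x : pb (fun y => conjc (phi y j a)) h x = iC * dphi h j a x.
Proof.
rewrite /pb (bigD1 j) //= [X in _ + X]big1 ?addr0; last first.
  move=> k kj; rewrite big1 // => b _.
  by rewrite dphi_conj dphibar_conj eq_sym (negbTE kj) !mul0r subrr.
rewrite (bigD1 a) //= [X in _ + X]big1 ?addr0; last first.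
  move=> b ba; rewrite dphi_conj dphibar_conj [a == b]eq_sym (negbTE ba) andbF.
  by rewrite !mul0r subrr.
by rewrite dphi_conj dphibar_conj !eqxx mul1r mul0r sub0r mulNr mulrN opprK.
Qed.

(** Arbitrary weights cover both the powers [lam a ^+ m] and the resolvent values [(t - lam a)^-1],
    so one bracket formula serves for both. *)
Definition wip w (i j : 'I_3) x : R[i] := \sum_(a < n.+1) w a * (conjc (phi x i a) * phi x j a).

Lemma wipB w w' i j x : wip (fun a => w a - w' a) i j x = wip w i j x - wip w' i j x.
Proof. by rewrite /wip -sumrB; apply: eq_bigr => a _; rewrite mulrBl. Qed.

Lemma wipZ c w i j x : wip (fun a => c * w a) i j x = c * wip w i j x.
Proof. by rewrite /wip mulr_sumr; apply: eq_bigr => a _; rewrite -mulrA. Qed.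

Lemma polyfun_pair i j a : polyfun (fun x => conjc (phi x i a) * phi x j a).
Proof. exact: (polyfunM (polyfun_conj i a) (polyfun_phi j a)). Qed.

Lemma polyfun_wip w i j : polyfun (wip w i j).
Proof.
apply: polyfun_sum => a; apply: polyfunM; first exact: polyfun_cst.
exact: polyfun_pair.
Qed.

(** Different sites commute; at one site the products satisfy the commutation relations of gl_3, up
    to the factor [- iC]. *)
Lemma pb_pair i j k l a b x :
  pb (fun y => conjc (phi y i a) * phi y j a) (fun y => conjc (phi y k b) * phi y l b) x =
  (a == b)%:R * (- iC * ((j == k)%:R * (conjc (phi x i a) * phi x l a)
         - (i == l)%:R * (conjc (phi x k a) * phi x j a))).
Proof.
have pp := polyfun_phi; have pc := polyfun_conj.
rewrite pbMl // !pbMr // !pb_phi !pb_conj !dphibar_phi !dphi_conj dphibar_conj dphi_phi.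
rewrite [l == i]eq_sym [k == j]eq_sym [b == a]eq_sym.
have [<-|_] := eqVneq a b; last by rewrite !andbF !mulr0n !(mulr0, mul0r, addr0).
rewrite !andbT mulr1n.
move: (conjc (phi x i a)) (conjc (phi x k a)) (phi x j a) (phi x l a) (@iC R) => b1 b2 b3 b4 c.
by move: (i == l)%:R (j == k)%:R => d1 d2; ring.
Qed.

Lemma pb_wip w w' i j k l x : pb (wip w i j) (wip w' k l) x =
  - iC * ((j == k)%:R * wip (fun a => w a * w' a) i l x
        - (i == l)%:R * wip (fun a => w a * w' a) k j x).
Proof.
rewrite /wip pb_suml; last by move=> a; exact: polyfun_pair.
under eq_bigr => a _.
  rewrite pb_sumr; last by move=> b; exact: polyfun_pair.
  under eq_bigr => b _ do rewrite pb_pair.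
  (* Sites decouple, so the double sum collapses to its diagonal, where the weights multiply. *)
  rewrite (bigD1 a) // eqxx mul1r big1 ?Monoid.mulm1; last first.
    by move=> b /andP[_]; rewrite eq_sym => /negbTE ->; rewrite mul0r mulr0.
  over.
rewrite !mulr_sumr -sumrB mulr_sumr; apply: eq_bigr => a _.
move: (conjc (phi x i a)) (conjc (phi x k a)) (phi x j a) (phi x l a) (@iC R) => b1 b2 b3 b4 c.
by move: (i == l)%:R (j == k)%:R (w a) (w' a) => d1 d2 d3 d4; ring.
Qed.

(** Both sides are derivations in [f], and on the generators they agree by Hamilton's equations. *)
Lemma cD_flow {V : normedModType R} (e : V) (sol : V -> PS R n) (H : PS R n -> R[i]) p :
  differentiable sol p ->
  (forall j a, iC * cD e (fun q => phi (sol q) j a) p = dphibar H j a (sol p)) ->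
  (forall j a, - iC * conjc (cD e (fun q => phi (sol q) j a) p) = dphi H j a (sol p)) ->
  forall f, polyfun f -> cD e (fun q => f (sol q)) p = pb f H (sol p).
Proof.
move=> dsol eqb eqp f; elim=> [c|j a|j a|{}f g pf IHf pg IHg|{}f g pf IHf pg IHg].
- by rewrite cD_cst pb_cstl.
- by rewrite pb_phi -eqb mulrA mulNr iC_sqr opprK mul1r.
- by rewrite pb_conj -eqp mulrA mulrN iC_sqr opprK mul1r cD_conj.
- by rewrite cDD; [rewrite pbDl // IHf IHg | exact: polyfun_cdifferentiable..].
- by rewrite cDM; [rewrite pbMl // IHf IHg | exact: polyfun_cdifferentiable..].
Qed.

End Brackets.

(* Polynomial expressions, so that brackets of concrete polynomials in given functions can be
   computed from the brackets of these functions by evaluation. *)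
Inductive pexpr (X C : Type) : Type :=
| PVar of X
| PCst of C
| PAdd of pexpr X C & pexpr X C
| PMul of pexpr X C & pexpr X C.

Arguments PVar {X C}.
Arguments PCst {X C}.

Section Expressions.
Context {X : Type} {C : comNzRingType}.

Fixpoint peval (v : X -> C) (e : pexpr X C) : C :=
  match e with
  | PVar i => v i
  | PCst c => c
  | PAdd e1 e2 => peval v e1 + peval v e2
  | PMul e1 e2 => peval v e1 * peval v e2
  end.

(** The value at [v] of the derivation that sends the variable [i] to [d i]; nesting two of them
    evaluates a bracket. *)
Fixpoint pderiv (v d : X -> C) (e : pexpr X C) : C :=
  match e with
  | PVar i => d i
  | PCst c => 0
  | PAdd e1 e2 => pderiv v d e1 + pderiv v d e2
  | PMul e1 e2 => pderiv v d e1 * peval v e2 + peval v e1 * pderiv v d e2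
  end.

Lemma eq_pderiv v d d' e : d =1 d' -> pderiv v d e = pderiv v d' e.
Proof. by move=> dd'; elim: e => //= [e1 -> e2 ->|e1 -> e2 ->]. Qed.

End Expressions.

Section BracketExpressions.
Context {R : realType} {n : nat} {X : Type} (v : X -> PS R n -> R[i]).
Hypothesis pv : forall i, polyfun (v i).

Lemma polyfun_peval e : polyfun (fun x => peval (v^~ x) e).
Proof.
elim: e => [i|c|e1 p1 e2 p2|e1 p1 e2 p2] /=; [exact: pv | exact: polyfun_cst | |].
- exact: polyfunD.
- exact: polyfunM.
Qed.

Lemma pb_pevall e g x :
  pb (fun x => peval (v^~ x) e) g x = pderiv (v^~ x) (fun i => pb (v i) g x) e.
Proof.
have pe := polyfun_peval.
elim: e => [i|c|e1 p1 e2 p2|e1 p1 e2 p2] //=; first exact: pb_cstl.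
- by rewrite pbDl // p1 p2.
- by rewrite pbMl // p1 p2.
Qed.

Lemma pb_pevalr e g x :
  pb g (fun x => peval (v^~ x) e) x = pderiv (v^~ x) (fun i => pb g (v i) x) e.
Proof.
have pe := polyfun_peval.
elim: e => [i|c|e1 p1 e2 p2|e1 p1 e2 p2] //=; first exact: pb_cstr.
- by rewrite pbDr // p1 p2.
- by rewrite pbMr // p1 p2.
Qed.

End BracketExpressions.

(** A bracket is a derivation in each argument, so the brackets of the variables determine it.
    Commutation thereby becomes a [ring] identity. *)
Lemma pb_peval {R : realType} {n : nat} {X Y : Type} (v : X -> PS R n -> R[i])
  (w : Y -> PS R n -> R[i]) (pv : forall i, polyfun (v i)) (pw : forall i, polyfun (w i))
  e e' x :
  pb (fun x => peval (v^~ x) e) (fun x => peval (w^~ x) e') x =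
  pderiv (v^~ x) (fun i => pderiv (w^~ x) (fun j => pb (v i) (w j) x) e') e.
Proof. by rewrite pb_pevall //; apply: eq_pderiv => i; rewrite pb_pevalr. Qed.

(** * Coefficients of the characteristic polynomial *)

Section CharacteristicCoefficients.
Context {K : comNzRingType}.

Definition pent (i j : 'I_3) : pexpr ('I_3 * 'I_3) K := PVar (i, j).
Definition psub (e1 e2 : pexpr ('I_3 * 'I_3) K) := PAdd e1 (PMul (PCst (-1)) e2).

Definition minor2 i j :=
  psub (PMul (pent i i) (pent j j)) (PMul (pent i j) (pent j i)).

(** The elementary invariant of degree [k.+1]: trace, sum of the principal 2x2 minors,
    determinant. *)
Definition charcoef (k : nat) : pexpr ('I_3 * 'I_3) K :=
  match k with
  | 0 => PAdd (PAdd (pent i0 i0) (pent i1 i1)) (pent i2 i2)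
  | 1 => PAdd (PAdd (minor2 i0 i1) (minor2 i0 i2)) (minor2 i1 i2)
  | _ => PAdd (psub
      (PMul (pent i0 i0) (minor2 i1 i2))
      (PMul (pent i0 i1) (psub (PMul (pent i1 i0) (pent i2 i2)) (PMul (pent i1 i2) (pent i2 i0)))))
      (PMul (pent i0 i2) (psub (PMul (pent i1 i0) (pent i2 i1)) (PMul (pent i1 i1) (pent i2 i0))))
  end.

Definition mxent (A : 'M[K]_3) (p : 'I_3 * 'I_3) := A p.1 p.2.

(** Homogeneity is what allows the denominators of the Lax matrix to be cleared entry by entry. *)
Lemma peval_charcoefZ (d : K) (v : 'I_3 * 'I_3 -> K) (k : 'I_3) :
  peval (fun p => d * v p) (charcoef k) = d ^+ k.+1 * peval v (charcoef k).
Proof. by case: k => -[|[|[|//]]] /= _; ring. Qed.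

(* The gradient of an invariant function of L commutes with L, so its bracket with an invariant
   function of L' vanishes as soon as {L_ij, L'_kl} has this r-matrix form. *)
Lemma charcoef_involution (c : K) (v w : 'I_3 * 'I_3 -> K) (k k' : 'I_3) :
  pderiv v (fun p => pderiv w (fun q =>
    c * ((p.1 == q.2)%:R * (v (q.1, p.2) - w (q.1, p.2))
         - (p.2 == q.1)%:R * (v (p.1, q.2) - w (p.1, q.2)))) (charcoef k')) (charcoef k) = 0.
Proof.
case: k => -[|[|[|//]]] /= _; case: k' => -[|[|[|//]]] /= _.
all: ring.
Qed.

End CharacteristicCoefficients.

Lemma char_poly3 {K : comNzRingType} (A : 'M[K]_3) :
  char_poly A = 'X^3 - (peval (mxent A) (charcoef 0))%:P * 'X^2
    + (peval (mxent A) (charcoef 1))%:P * 'X - (peval (mxent A) (charcoef 2))%:P.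
Proof.
rewrite /char_poly (expand_det_row _ i0) !big_ord_recl big_ord0 /cofactor.
rewrite !(expand_det_row _ ord0) !big_ord_recl !big_ord0 /cofactor !det_mx11 /= !mxE /=.
(* Cofactor expansion produces ordinals of equal value but different form; reading [A] through
   natural indices identifies them for [ring]. *)
have [a aE] : exists a : nat -> nat -> K, forall i j, A i j = a i j.
  by exists (fun k l => A (inord k) (inord l)) => i j; rewrite !inord_val.
rewrite /mxent /= !aE /= /bump /= !(mulr1n, mulr0n) !add0n !addn0; ring.
Qed.

Lemma charcoefE {K : comNzRingType} (A : 'M[K]_3) (k : 'I_3) :
  (-1) ^+ k.+1 * (char_poly A)`_(3 - k.+1) = peval (mxent A) (charcoef k).
Proof.
rewrite char_poly3; set e0 := peval _ (charcoef 0); set e1 := peval _ (charcoef 1).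
set e2 := peval _ (charcoef 2).
case: k => -[|[|[|//]]] /= _; rewrite !(coefB, coefD, coefCM, coefMX, coefXn, coefX, coefC) /=;
  rewrite /e0 /e1 /e2 /=; ring.
Qed.

(** * Involution of the integrals *)

Section TruncatedEquality.
Context {K : comNzRingType} (M : nat).
Implicit Types (p q : {poly K}).

(** Congruence modulo ['X^(M.+1)]. *)
Definition eqtrunc p q := forall s, (s <= M)%N -> p`_s = q`_s.

Lemma eqtruncD p q p' q' : eqtrunc p q -> eqtrunc p' q' -> eqtrunc (p + p') (q + q').
Proof. by move=> pq pq' s sM; rewrite !coefD pq ?pq'. Qed.

Lemma eqtruncM p q p' q' : eqtrunc p q -> eqtrunc p' q' -> eqtrunc (p * p') (q * q').
Proof.
move=> pq pq' s sM; rewrite !coefM; apply: eq_bigr => -[i /= /ltnSE si] _.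
by rewrite pq ?pq' //; [apply: leq_trans sM; exact: leq_subr | exact: leq_trans sM].
Qed.

Lemma eqtruncXn p r : eqtrunc (p + 'X^(M.+1) * r) p.
Proof. by move=> s sM; rewrite coefD coefXnM ltnS sM addr0. Qed.

Lemma eqtrunc_exp p q k : eqtrunc p q -> eqtrunc (p ^+ k) (q ^+ k).
Proof. by move=> pq; elim: k => [s _|k IH] //; rewrite !exprS; apply: eqtruncM. Qed.

Lemma eqtrunc_prod (I : Type) (r : seq I) (F G : I -> {poly K}) :
  (forall i, eqtrunc (F i) (G i)) -> eqtrunc (\prod_(i <- r) F i) (\prod_(i <- r) G i).
Proof.
move=> FG; elim: r => [|i r IH]; first by rewrite !big_nil.
by rewrite !big_cons; apply: eqtruncM.
Qed.

Lemma eqtrunc_peval (X : Type) (v w : X -> {poly K}) e :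
  (forall i, eqtrunc (v i) (w i)) -> eqtrunc (peval v e) (peval w e).
Proof.
by move=> vw; elim: e => [i|c|e1 IH1 e2 IH2|e1 IH1 e2 IH2] //=; [exact: eqtruncD | exact: eqtruncM].
Qed.

End TruncatedEquality.

(** * Families of polynomials of uniformly bounded degree *)

Section UniformlyBoundedSize.
Context {T : Type} {K : comNzRingType}.
Implicit Types F G : T -> {poly K}.

(** One bound for all [x]: the interpolation nodes must not depend on the point of the phase
    space. *)
Definition bsize F := exists N, forall x, (size (F x) <= N)%N.

Lemma bsize_cst p : bsize (fun=> p).
Proof. by exists (size p). Qed.

Lemma bsizeC (f : T -> K) : bsize (fun x => (f x)%:P).
Proof. by exists 1 => x; exact: size_polyC_leq1. Qed.

Lemma bsizeD F G : bsize F -> bsize G -> bsize (fun x => F x + G x).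
Proof.
move=> [N FN] [N' GN]; exists (maxn N N') => x; apply: leq_trans (size_polyD _ _) _.
by rewrite geq_max !leq_max FN GN orbT.
Qed.

Lemma bsizeM F G : bsize F -> bsize G -> bsize (fun x => F x * G x).
Proof.
move=> [N FN] [N' GN]; exists (N + N')%N => x; apply: leq_trans (size_polyMleq _ _) _.
by apply: leq_trans (leq_pred _) _; exact: leq_add.
Qed.

Lemma bsize_sum (I : Type) (r : seq I) (F : I -> T -> {poly K}) :
  (forall i, bsize (F i)) -> bsize (fun x => \sum_(i <- r) F i x).
Proof.
move=> bF; elim: r => [|i r [N FN]].
  by exists 0 => x; rewrite big_nil size_poly0.
have [N' FN'] := bF i; exists (maxn N' N) => x; rewrite big_cons.
by apply: leq_trans (size_polyD _ _) _; rewrite geq_max !leq_max FN FN' orbT.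
Qed.

Lemma bsize_peval (X : Type) (v : T -> X -> {poly K}) e :
  (forall i, bsize (v^~ i)) -> bsize (fun x => peval (v x) e).
Proof.
move=> bv; elim: e => [i|c|e1 IH1 e2 IH2|e1 IH1 e2 IH2] /=; first exact: bv.
- exact: bsize_cst.
- exact: bsizeD.
- exact: bsizeM.
Qed.

End UniformlyBoundedSize.

Lemma horner_charcoef {K : comNzRingType} (v : 'I_3 * 'I_3 -> {poly K}) k z :
  (peval v (charcoef k)).[z] = peval (fun p => (v p).[z]) (charcoef k).
Proof. by case: k => [|[|k]] /=; rewrite !hornerE. Qed.

(** * The Lax matrix: r-matrix bracket, clearing of denominators, interpolation *)

Section Lax.
Context {R : realType} {n : nat} (lam : 'I_n.+1 -> R).
Implicit Types (x : PS R n) (t s : R) (p q : 'I_3 * 'I_3).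

(** The entry [p] of L(t). The indices of [wip] are swapped because the first factor in a moment is
    the conjugated one. *)
Definition lax t p x : R[i] :=
  Cmat p.1 p.2 + wip (fun a => ofR (t - lam a)^-1) p.2 p.1 x.

Lemma polyfun_lax t p : polyfun (lax t p).
Proof. by apply: polyfunD; [exact: polyfun_cst | exact: polyfun_wip]. Qed.

(** The product of the weights splits by partial fractions, 1/((t - l)(s - l)) = (1/(t - l) - 1/(s -
    l))/(s - t), and the constant entries of [Cmat] cancel in the differences. *)
Lemma pb_lax t s p q x : (forall a, t != lam a) -> (forall a, s != lam a) -> t != s ->
  pb (lax t p) (lax s q) x =
  - iC * ofR (s - t)^-1 *
    ((p.1 == q.2)%:R * (lax t (q.1, p.2) x - lax s (q.1, p.2) x)
     - (p.2 == q.1)%:R * (lax t (p.1, q.2) x - lax s (p.1, q.2) x)).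
Proof.
move=> tlam slam ts; case: p q => [i j] [k l] /=.
rewrite pbDl ?pb_cstl ?add0r; [|exact: polyfun_cst|exact: polyfun_wip].
rewrite pbDr ?pb_cstr ?add0r; [|exact: polyfun_cst|exact: polyfun_wip].
rewrite pb_wip /lax /=.
have wE i' j' : wip (fun a => ofR (t - lam a)^-1 * ofR (s - lam a)^-1) i' j' x =
    ofR (s - t)^-1 * (wip (fun a => ofR (t - lam a)^-1) i' j' x
                      - wip (fun a => ofR (s - lam a)^-1) i' j' x).
  rewrite -wipB -wipZ; congr wip; apply/funext => a; rewrite -ofRB -!ofRM; congr ofR.
  by field; rewrite !subr_eq0 tlam slam eq_sym ts.
rewrite !wE -!mulrA; congr (_ * _).
move: (Cmat k j) (Cmat i l) => c1 c2; move: (wip _ _ _ x) (wip _ _ _ x) (wip _ _ _ x) (wip _ _ _ x) => w1 w2 w3 w4.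
by move: (i == l)%:R (j == k)%:R (ofR _) => d1 d2 d3; ring.
Qed.

Definition laxcoef (k : nat) t x := peval (fun p => lax t p x) (charcoef k).

Lemma polyfun_laxcoef k t : polyfun (laxcoef k t).
Proof. exact: (polyfun_peval (polyfun_lax t)). Qed.

Lemma pb_laxcoef (k k' : 'I_3) t s x :
  (forall a, t != lam a) -> (forall a, s != lam a) -> t != s ->
  pb (laxcoef k t) (laxcoef k' s) x = 0.
Proof.
move=> tlam slam ts; rewrite (pb_peval (polyfun_lax t) (polyfun_lax s)).
rewrite -[RHS](charcoef_involution (- iC * ofR (s - t)^-1)
  (fun p => lax t p x) (fun q => lax s q x) k k').
by apply: eq_pderiv => p; apply: eq_pderiv => q; exact: pb_lax.
Qed.

Definition denfac (a : 'I_n.+1) : {poly R[i]} := 1 - (ofR (lam a))%:P * 'X.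
Definition den := \prod_a denfac a.

(** [den] times L in the variable z = 1/lambda, using 1/(lambda - l) = z/(1 - l z). *)
Definition laxnum x p : {poly R[i]} :=
  den * (Cmat p.1 p.2)%:P +
  \sum_a 'X * (\prod_(b | b != a) denfac b) * (FF x a p.1 p.2)%:P.

Lemma Ltrunc_ent M x p : mxent (Ltrunc lam M x) p =
  (Cmat p.1 p.2)%:P +
  \sum_(a < n.+1) (\sum_(k < M) 'X^(k.+1) * (ofR (lam a ^+ k))%:P) * (FF x a p.1 p.2)%:P.
Proof.
rewrite /mxent !mxE summxE; congr (_ + _); apply: eq_bigr => a _.
by rewrite summxE mulr_suml; apply: eq_bigr => k _; rewrite !mxE.
Qed.

(** The product telescopes to z - l^M z^(M+1). *)
Lemma den_geometric M a : eqtrunc M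
  (denfac a * \sum_(k < M) 'X^(k.+1) * (ofR (lam a ^+ k))%:P) 'X.
Proof.
set l := ofR (lam a).
rewrite [X in eqtrunc _ X _](_ : _ = 'X + 'X^(M.+1) * - (l ^+ M)%:P); first exact: eqtruncXn.
have -> : \sum_(k < M) 'X^(k.+1) * (ofR (lam a ^+ k))%:P =
    'X * \sum_(k < M) (l%:P * 'X) ^+ k :> {poly R[i]}.
  rewrite mulr_sumr; apply: eq_bigr => k _.
  by rewrite ofRX polyC_exp exprMn exprS -mulrA [_ * 'X^k]mulrC.
rewrite mulrCA -[denfac a]opprB mulNr -subrX1 exprMn polyC_exp exprS.
by ring.
Qed.

Lemma den_Ltrunc M x p : eqtrunc M (den * mxent (Ltrunc lam M x) p) (laxnum x p).
Proof.
rewrite Ltrunc_ent mulrDr /laxnum; apply: eqtruncD => //.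
rewrite mulr_sumr => s sM; rewrite !coef_sum; apply: eq_bigr => a _.
move: s sM; rewrite -/(eqtrunc _ _ _) mulrA; apply: eqtruncM => //.
rewrite /den (bigD1 a) //= mulrAC; apply: eqtruncM => //.
exact: den_geometric.
Qed.

(** Each factor of [den] has constant term 1, and a truncated geometric series inverts it. *)
Lemma den_inverse M : exists g, eqtrunc M (g * den) 1.
Proof.
exists (\prod_a \sum_(k < M.+1) ((ofR (lam a))%:P * 'X) ^+ k); rewrite /den -big_split /=.
rewrite [X in eqtrunc _ _ X](_ : 1 = \prod_(a < n.+1) 1); last by rewrite big1.
apply: eqtrunc_prod => a; rewrite mulrC -[denfac a]opprB mulNr -subrX1 opprB exprMn mulrC.
by rewrite -mulrN; exact: eqtruncXn.
Qed.

(** Homogeneity of degree [k.+1] moves the power of [den] inside [charcoef k], so the power of its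
    truncated inverse recovers the coefficient. That multiplier does not depend on [x]. *)
Lemma E_laxnum (k : 'I_3) m : exists G, forall x,
  E lam k m x = (G * peval (laxnum x) (charcoef k))`_m.+1.
Proof.
have [g gden] := den_inverse m.+1; exists (g ^+ k.+1) => x.
rewrite /E /pk charcoefE; set A := Ltrunc _ _ _.
have refl (r : {poly R[i]}) : eqtrunc m.+1 r r by [].
rewrite -[peval _ _]mul1r -(expr1n _ k.+1).
rewrite -(eqtruncM (eqtrunc_exp k.+1 gden) (refl _)) //.
rewrite exprMn -mulrA -peval_charcoefZ (eqtruncM (refl _) (q' := peval (laxnum x) (charcoef k))) //.
by apply: eqtrunc_peval => p; exact: den_Ltrunc.
Qed.

Lemma bsize_laxnum p : bsize (laxnum^~ p).
Proof.
apply: bsizeD; first exact: bsize_cst.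
by apply: bsize_sum => a; apply: bsizeM; [exact: bsize_cst | exact: bsizeC].
Qed.

Lemma horner_denfac a z : (denfac a).[z] = 1 - ofR (lam a) * z.
Proof. by rewrite /denfac !hornerE. Qed.

Lemma horner_laxnum t x p : t != 0 -> (forall a, t != lam a) ->
  (laxnum x p).[(ofR t)^-1] = den.[(ofR t)^-1] * lax t p x.
Proof.
move=> t0 tlam; rewrite /laxnum /lax /wip mulrDr !hornerE; congr (_ + _).
rewrite horner_sum mulr_sumr; apply: eq_bigr => a _.
have ta : ofR t - ofR (lam a) != 0 by rewrite -ofRB ofR_eq0 subr_eq0.
have t0' : ofR t != 0 by rewrite ofR_eq0.
rewrite [den](bigD1 a) //; set Q := \prod_(b | _) _.
rewrite !hornerM hornerX hornerC horner_denfac [FF x a _ _]mxE ofRV ofRB.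
move: Q.[_] (phi x p.1 a) (conjc _) ta t0'.
move: (ofR t) (ofR (lam a)) => u v c1 c2 c3 ta t0'.
by field; rewrite t0' ta.
Qed.

(** The nodes z = 1/(B + s) correspond to points beyond every [lam a]. The starting point [B] stays
    free, so that two integrals can be sampled at disjoint sets of points. *)
Lemma E_laxcoef (k : 'I_3) m (B : nat) : (0 < B)%N -> (forall a, lam a < B%:R) ->
  exists (N : nat) (c : 'I_N -> R[i]), forall x,
    E lam k m x = \sum_(s < N) c s * laxcoef k (B + s)%:R x.
Proof.
move=> B0 Blam; have [G EG] := E_laxnum k m.
have [N sizeN] := bsize_peval (charcoef k) bsize_laxnum.
have nz (s : nat) : (B + s)%:R != 0 :> R by rewrite pnatr_eq0 addn_eq0 negb_and -lt0n B0.
have nlam (s : nat) a : (B + s)%:R != lam a.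
  by rewrite gt_eqF // (lt_le_trans (Blam a)) // ler_nat leq_addr.
pose z (s : nat) : R[i] := (ofR (B + s)%:R)^-1.
have z_inj : injective z.
  by move=> s s' /invr_inj/ofR_inj/eqP; rewrite eqr_nat eqn_add2l => /eqP.
(* Each weight is a coefficient of [G] times a Lagrange basis polynomial, times the power of [den]
   that [laxnum] carries at the node. Taking [N.+1] nodes keeps their number positive. *)
exists N.+1, (fun s : 'I_N.+1 => (G * tnth (N.+1.-lagrange z) s)`_m.+1 * den.[z s] ^+ k.+1) => x.
rewrite EG (lagrange_gen (ltn0Sn N) z_inj (leqW (sizeN x))).
rewrite mulr_sumr coef_sum; apply: eq_bigr => s _.
rewrite mulrCA coefCM mulrC -mulrA horner_charcoef; congr (_ * _).
by rewrite /laxcoef -peval_charcoefZ; congr peval; apply/funext => p; exact: horner_laxnum.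
Qed.

Lemma lam_bound : exists2 B, (0 < B)%N & forall a, lam a < B%:R.
Proof.
exists (\max_a Num.bound (lam a)).+1 => // a.
apply: (lt_trans (unstable.ltr_bound (lam a))).
by rewrite ltr_nat ltnS (leq_bigmax (F := fun a => Num.bound (lam a))).
Qed.

(** Read off from the interpolation formula, whose terms are polynomials in the entries of L at
    fixed points. *)
Lemma polyfun_E (k : 'I_3) m : polyfun (E lam k m).
Proof.
have [B B0 Blam] := lam_bound; have [N [c Ec]] := E_laxcoef k m B0 Blam.
rewrite (funext Ec); apply: polyfun_sum => s; apply: polyfunM; first exact: polyfun_cst.
exact: polyfun_laxcoef.
Qed.

Lemma E_involution (k k' : 'I_3) m m' : poisson_commute (E lam k m) (E lam k' m').
Proof.
move=> x; have [B B0 Blam] := lam_bound; have [N [c Ec]] := E_laxcoef k m B0 Blam.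
(* The second family of nodes starts after the [N] nodes of the first, so every pair of sample
   points is distinct. *)
have [|a|N' [c' Ec']] := @E_laxcoef k' m' (B + N); first by rewrite addn_gt0 B0.
  by rewrite (lt_le_trans (Blam a)) // ler_nat leq_addr.
have nlam (s' : nat) a : (B + s')%:R != lam a.
  by rewrite gt_eqF // (lt_le_trans (Blam a)) // ler_nat leq_addr.
rewrite (funext Ec) (funext Ec') pb_suml; last by move=> s; exact: polyfun_laxcoef.
rewrite big1 // => s _; rewrite pb_sumr; last by move=> s'; exact: polyfun_laxcoef.
rewrite big1 ?mulr0 // => s' _; rewrite pb_laxcoef ?mulr0 // => [a|].
  by rewrite -addnA.
by rewrite eqr_nat -addnA eqn_add2l neq_ltn ltn_addr.
Qed.

End Lax.

(** * The Hamiltonians *)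

Section HamiltonianExpressions.
Context {K : comNzRingType}.
Implicit Types (G : nat -> 'I_3 -> 'I_3 -> K).

Notation expr := (pexpr (nat * 'I_3 * 'I_3) K).

Definition pip m i j : expr := PVar (m, i, j).
Definition pscale (c : K) (e : expr) := PMul (PCst c) e.
(** Conjugating a moment swaps its indices, so squared moduli, and twice the real parts in [pre],
    are written without conjugation. *)
Definition pabsq i j := PMul (pip 0 i j) (pip 0 j i).
Definition pre m m' i j := PAdd (PMul (pip m i j) (pip m' j i)) (PMul (pip m j i) (pip m' i j)).
Definition pdiff i j := PAdd (pip 0 i i) (pscale (-1) (pip 0 j j)).

Definition pHx : expr :=
  PAdd (PAdd (pscale (-1) (pip 1 i0 i0)) (pscale (-1) (pip 1 i1 i1)))
       (PAdd (pscale (-1) (pabsq i0 i2)) (pabsq i1 i2)).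

Definition pHy : expr :=
  PAdd (PAdd (pscale (-1) (pip 1 i0 i0)) (pip 1 i1 i1))
       (pscale (-1) (PAdd (PAdd (pabsq i0 i2) (pabsq i1 i2)) (pabsq i0 i1))).

Definition pHt : expr :=
  PAdd (pscale 2 (PAdd (PAdd (PAdd (pip 2 i0 i0) (pscale (-1) (pip 2 i1 i1)))
                             (PAdd (pre 0 1 i0 i2) (pre 0 1 i1 i2)))
                       (pre 0 1 i0 i1)))
       (PAdd (pscale 2 (PAdd (PMul (pdiff i2 i0) (pabsq i0 i2))
                             (pscale (-1) (PMul (pdiff i2 i1) (pabsq i1 i2)))))
             (pscale (-1) (PMul (pdiff i0 i1) (pabsq i0 i1)))).

Definition pH (s : nat) := match s with 0 => pHx | 1 => pHy | _ => pHt end.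

Definition ipval G (p : nat * 'I_3 * 'I_3) := G p.1.1 p.1.2 p.2.

(** The Lie-Poisson bracket of the polynomial loop algebra of gl_3, scaled by [c]: the powers of
    Lambda add up. *)
Definition ipbr (c : K) G (p q : nat * 'I_3 * 'I_3) : K :=
  c * ((p.2 == q.1.2)%:R * G (p.1.1 + q.1.1)%N p.1.2 q.2
       - (p.1.2 == q.2)%:R * G (p.1.1 + q.1.1)%N q.1.2 p.2).

Definition ham_deriv (c : K) G (s : nat) (e : expr) : K :=
  pderiv (ipval G) (fun p => pderiv (ipval G) (ipbr c G p) (pH s)) e.

(** An identity in the moments taken as free variables; no relation between them enters. *)
Lemma ham_involution c G (s s' : 'I_3) : ham_deriv c G s (pH s') = 0.
Proof.
by case: s => -[|[|[|//]]] /= _; case: s' => -[|[|[|//]]] /= _;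
  rewrite /ham_deriv /ipval /ipbr /= !addn0 ?add0n ?addn1 ?addn2; ring.
Qed.

(** The entries of [Cmat] in a form that computes on concrete indices. *)
Definition Centry (p : 'I_3 * 'I_3) : K :=
  if p.1 == p.2 then if p.1 == i0 then 1 else if p.1 == i1 then -1 else 0 else 0.

(* The moment of order [m] of the weights [1 / (t - lam a)], reduced by
   [lam ^ m / (t - lam) = t ^ m / (t - lam) - (t ^ (m - 1) + ... + lam ^ (m - 1))]. *)
Definition laxmoment (t : K) (v : 'I_3 * 'I_3 -> K) G (m : nat) (i j : 'I_3) : K :=
  t ^+ m * (v (j, i) - Centry (j, i)) - \sum_(r < m) t ^+ (m.-1 - r) * G r i j.

(** Again a polynomial identity, now with [t], the entries of L(t) and the moments as free
    variables. The Hamiltonians contain moments of order at most 2, so three cases of [laxmoment]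
    suffice. *)
Lemma charcoef_ham_involution (c t : K) (v : 'I_3 * 'I_3 -> K) G (k s : 'I_3) :
  pderiv v (fun p => pderiv (ipval G) (fun q =>
    c * ((p.1 == q.1.2)%:R * laxmoment t v G q.1.1 p.2 q.2
         - (p.2 == q.2)%:R * laxmoment t v G q.1.1 q.1.2 p.1)) (pH s)) (charcoef k) = 0.
Proof.
have m0 i j : laxmoment t v G 0 i j = v (j, i) - Centry (j, i).
  by rewrite /laxmoment big_ord0 subr0 mul1r.
have m1 i j : laxmoment t v G 1 i j = t * (v (j, i) - Centry (j, i)) - G 0 i j.
  by rewrite /laxmoment big_ord_recl big_ord0 addr0 mul1r.
have m2 i j : laxmoment t v G 2 i j =
    t ^+ 2 * (v (j, i) - Centry (j, i)) - t * G 0 i j - G 1 i j.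
  by rewrite /laxmoment !big_ord_recl big_ord0 addr0 mul1r opprD addrA.
case: k => -[|[|[|//]]] /= _; case: s => -[|[|[|//]]] /= _;
  rewrite /ipval /= ?m0 ?m1 ?m2 /Centry /=; ring.
Qed.

(** [pux] and [puy] are u_x and u_y in terms of the moments: the factor i of u cancels
    [c = - iC]. *)
Definition pux : expr := pscale (-2) (PMul (pip 0 i1 i2) (pip 0 i2 i0)).
Definition puy : expr := PAdd (pscale (-2) (pip 1 i1 i0)) (PMul (pdiff i0 i1) (pip 0 i1 i0)).

Lemma ham_deriv_ux c G : ham_deriv c G 0 (pip 0 i1 i0) = c * peval (ipval G) pux.
Proof. by rewrite /ham_deriv /ipval /ipbr /=; ring. Qed.

Lemma ham_deriv_uy c G : ham_deriv c G 1 (pip 0 i1 i0) = c * peval (ipval G) puy.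
Proof. by rewrite /ham_deriv /ipval /ipbr /= ?add0n; ring. Qed.

(** For [c = - iC] this is the evolution equation of u: the left side is -i u_t, and the last term
    gives the cubic and the potential terms. *)
Lemma ham_deriv_ut c G : ham_deriv c G 2 (pip 0 i1 i0) =
  ham_deriv c G 0 pux + ham_deriv c G 1 puy
  - c * (2 * (G 0 i0 i1 * G 0 i1 i0) * G 0 i1 i0
         + 2 * (2 * (G 0 i2 i0 * G 0 i0 i2) + 2 * (G 0 i2 i1 * G 0 i1 i2)) * G 0 i1 i0).
Proof. by rewrite /ham_deriv /ipval /ipbr /= ?addn0 ?add0n ?addn1; ring. Qed.

Lemma ham_deriv_v1 c G :
  2 * (ham_deriv c G 0 (pabsq i2 i0) - ham_deriv c G 1 (pabsq i2 i0)) =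
  - ham_deriv c G 0 (pabsq i0 i1).
Proof. by rewrite /ham_deriv /ipval /ipbr /= ?addn0 ?add0n ?addn1; ring. Qed.

Lemma ham_deriv_v2 c G :
  2 * (ham_deriv c G 0 (pabsq i2 i1) + ham_deriv c G 1 (pabsq i2 i1)) =
  - ham_deriv c G 0 (pabsq i0 i1).
Proof. by rewrite /ham_deriv /ipval /ipbr /= ?addn0 ?add0n ?addn1; ring. Qed.

End HamiltonianExpressions.

(** * From the formal identities to brackets on the phase space *)

Section IntegralsAndHamiltonians.
Context {R : realType} {n : nat} (lam : 'I_n.+1 -> R).
Implicit Types (x : PS R n) (e : pexpr (nat * 'I_3 * 'I_3) R[i]).

Definition ipvar (p : nat * 'I_3 * 'I_3) x : R[i] := ip lam p.1.1 p.1.2 p.2 x.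

Lemma ip_wip m i j : ip lam m i j = wip (fun a => ofR (lam a ^+ m)) i j.
Proof. by apply/funext => x; apply: eq_bigr => a _; rewrite mulrA. Qed.

Lemma polyfun_ip m i j : polyfun (ip lam m i j).
Proof. by rewrite ip_wip; exact: polyfun_wip. Qed.

Lemma polyfun_ipvar p : polyfun (ipvar p).
Proof. exact: polyfun_ip. Qed.

Lemma conjc_ip m i j x : conjc (ip lam m i j x) = ip lam m j i x.
Proof.
rewrite /ip (big_morph conjc conjcD (conjc_ofR 0)).
apply: eq_bigr => a _; rewrite !conjcM conjc_ofR conjcK.
by rewrite -mulrA [phi _ _ _ * _]mulrC mulrA.
Qed.

Lemma pb_ip p q x : pb (ipvar p) (ipvar q) x = ipbr (- iC) (fun m i j => ip lam m i j x) p q.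
Proof.
rewrite /ipvar !ip_wip pb_wip /ipbr !ip_wip.
have wE i j : wip (fun a => ofR (lam a ^+ p.1.1) * ofR (lam a ^+ q.1.1)) i j x =
    wip (fun a => ofR (lam a ^+ (p.1.1 + q.1.1))) i j x.
  by congr wip; apply/funext => a; rewrite -ofRM exprD.
by rewrite !wE.
Qed.

Lemma HsE (s : 'I_3) : Hs lam s = fun x => peval (ipvar^~ x) (pH s).
Proof.
apply/funext => x; case: s => -[|[|[|//]]] /= ?; rewrite /Hs /= /ipvar /=.
- by rewrite /Hx !absqE !conjc_ip; ring.
- by rewrite /Hy !absqE !conjc_ip; ring.
- rewrite /Ht /Omega !absqE !conjc_ip.
  have re4 z : ofR (4 * reC z) = 2 * (z + conjc z) :> R[i].
    by rewrite -reCE -(ofR_nat 2) -ofRM mulrA -natrM.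
  rewrite !re4 !conjcM !conjc_ip; ring.
Qed.

Lemma pb_Hs e (s : 'I_3) x : pb (fun x => peval (ipvar^~ x) e) (Hs lam s) x =
  ham_deriv (- iC) (fun m i j => ip lam m i j x) s e.
Proof.
rewrite HsE (pb_peval polyfun_ipvar polyfun_ipvar).
by apply: eq_pderiv => p; apply: eq_pderiv => q; exact: pb_ip.
Qed.

Lemma Hs_involution s s' : poisson_commute (Hs lam s) (Hs lam s').
Proof. by move=> x; rewrite [X in pb X]HsE pb_Hs ham_involution. Qed.

Lemma CmatE p : Cmat p.1 p.2 = Centry p :> R[i].
Proof. by rewrite mxE. Qed.

(** Dividing [lam a ^+ m] by [t - lam a] leaves [t ^+ m] over [t - lam a] minus a polynomial in
    [lam a], whose moments are ordinary ones. *)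
Lemma wip_moment t m i j x : (forall a, t != lam a) ->
  wip (fun a => ofR (t - lam a)^-1 * ofR (lam a ^+ m)) i j x =
  laxmoment (ofR t) (fun p => lax lam t p x) (fun m i j => ip lam m i j x) m i j.
Proof.
move=> tlam; rewrite /laxmoment -CmatE /lax addrAC subrr add0r /=.
rewrite -ofRX -wipZ.
have -> : \sum_(r < m) ofR t ^+ (m.-1 - r) * ip lam r i j x =
    wip (fun a => ofR (\sum_(r < m) t ^+ (m.-1 - r) * lam a ^+ r)) i j x.
  under eq_bigr => r _ do rewrite ip_wip -ofRX -wipZ.
  rewrite /wip exchange_big /=; apply: eq_bigr => a _; rewrite -mulr_suml; congr (_ * _).
  rewrite (big_morph ofR (@ofRD R) (erefl _)).
  by apply: eq_bigr => r _; rewrite ofRM.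
rewrite -wipB; congr wip; apply/funext => a; rewrite -!ofRM -ofRB; congr ofR.
have ta : t - lam a != 0 by rewrite subr_eq0.
apply: (mulfI ta); rewrite mulrBr [in RHS]mulrCA divff // mulr1 mulrA divff // mul1r.
(* The exponents use [m.-1], so the empty sum at [m = 0] is treated apart. *)
case: m => [|m]; first by rewrite big_ord0 mulr0 subr0.
by rewrite -subrXX opprB addrC subrK.
Qed.

Lemma pb_lax_ip t p q x : (forall a, t != lam a) ->
  let mom := laxmoment (ofR t) (fun p => lax lam t p x) (fun m i j => ip lam m i j x) in
  pb (lax lam t p) (ipvar q) x =
  - iC * ((p.1 == q.1.2)%:R * mom q.1.1 p.2 q.2 - (p.2 == q.2)%:R * mom q.1.1 q.1.2 p.1).
Proof.
move=> tlam mom; rewrite /ipvar ip_wip.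
rewrite pbDl ?pb_cstl ?add0r; [|exact: polyfun_cst|exact: polyfun_wip].
by rewrite pb_wip !wip_moment.
Qed.

Lemma E_Hs_commute (k s : 'I_3) m : poisson_commute (E lam k m) (Hs lam s).
Proof.
move=> x; have [B B0 Blam] := lam_bound lam; have [N [c Ec]] := E_laxcoef k m B0 Blam.
rewrite (funext Ec) pb_suml; last by move=> i; exact: polyfun_laxcoef.
rewrite big1 // => i _; rewrite HsE (pb_peval (polyfun_lax lam _) polyfun_ipvar).
have nlam a : (B + i)%:R != lam a.
  by rewrite gt_eqF // (lt_le_trans (Blam a)) // ler_nat leq_addr.
rewrite [X in _ * X](_ : _ = 0) ?mulr0 //.
rewrite -[RHS](charcoef_ham_involution (- iC) (ofR (B + i)%:R)
  (fun p => lax lam (B + i)%:R p x) (fun m i j => ip lam m i j x) k s).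
by apply: eq_pderiv => p; apply: eq_pderiv => q; exact: pb_lax_ip.
Qed.

(** * Simultaneous solutions and the Davey-Stewartson equation *)

Section DaveyStewartson.
Variables (D : set 'rV[R]_3) (sol : 'rV[R]_3 -> PS R n).
Hypotheses (oD : open D) (smooth_sol : smooth3 D sol) (ham_sol : ham_solution lam D sol).

Lemma cD_along s f p : polyfun f -> D p -> cD (ed s) (fun q => f (sol q)) p = pb f (Hs lam s) (sol p).
Proof.
move=> pf Dp; have dsol : differentiable sol p by exact: (smooth_sol [::]).
apply: cD_flow => // j a; rewrite (cD_phi dsol); have [eqb eqp] := ham_sol s j a Dp.
  exact: eqb.
exact: eqp.
Qed.

Lemma cD_peval s e p : D p -> cD (ed s) (fun q => peval (ipvar^~ (sol q)) e) p =
  ham_deriv (- iC) (fun m i j => ip lam m i j (sol p)) s e.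
Proof.
by move=> Dp; rewrite (cD_along s (polyfun_peval polyfun_ipvar e)) // pb_Hs.
Qed.

Let u q : R[i] := iC * ip lam 0 i1 i0 (sol q).

Lemma cD_u s p : D p ->
  cD (ed s) u p = iC * ham_deriv (- iC) (fun m i j => ip lam m i j (sol p)) s (pip 0 i1 i0).
Proof.
move=> Dp; rewrite (cD_peval s (pscale iC (pip 0 i1 i0)) Dp).
by rewrite /ham_deriv /= mul0r add0r.
Qed.

(** The first derivative of [u] equals the expression [e] only on [D]; as [D] is open, the equality
    holds near [p] and may be differentiated. *)
Lemma cD_u_twice (s : 'I_3) e p : D p ->
  (forall G, ham_deriv (- iC) G s (pip 0 i1 i0) = - iC * peval (ipval G) e :> R[i]) ->
  cD (ed s) (cD (ed s) u) p = ham_deriv (- iC) (fun m i j => ip lam m i j (sol p)) s e.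
Proof.
move=> Dp De; rewrite -cD_peval //; apply: near_eq_cD.
have : nbhs p D by apply: open_nbhs_nbhs.
by apply: filterS => q Dq; rewrite cD_u // De mulrA mulrN iC_sqr opprK mul1r.
Qed.

Lemma derive_absq s i j p : D p -> ofR ('D_(ed s) (fun q => absq (ip lam 0 i j (sol q))) p) =
  ham_deriv (- iC) (fun m i j => ip lam m i j (sol p)) s (pabsq i j).
Proof.
move=> Dp; rewrite -cD_ofR -cD_peval //; congr (cD _ _ p); apply/funext => q.
by rewrite absqE conjc_ip.
Qed.

Lemma derive_double_absq s i j p : D p ->
  ofR ('D_(ed s) (fun q => 2 * absq (ip lam 0 i j (sol q))) p) =
  2 * ham_deriv (- iC) (fun m i j => ip lam m i j (sol p)) s (pabsq i j).
Proof.
move=> Dp.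
transitivity (ham_deriv (- iC) (fun m i j => ip lam m i j (sol p)) s (pscale 2 (pabsq i j))).
  2: by rewrite /ham_deriv /= mul0r add0r.
rewrite -cD_peval // -cD_ofR; congr (cD _ _ p); apply/funext => q.
by rewrite ofRM absqE conjc_ip; congr (_ * _); exact: (ofR_nat 2).
Qed.

Lemma absq_u q : absq (u q) = absq (ip lam 0 i0 i1 (sol q)).
Proof.
apply: ofR_inj; rewrite /u !absqE conjcM !conjc_ip mulrACA.
have -> : iC * conjc iC = 1 :> R[i] by rewrite -absqE /absq /= expr0n expr1n add0r.
by rewrite mul1r mulrC.
Qed.

Lemma DSI_solution :
  DSI D u (fun p => 2 * absq (ip lam 0 i2 i0 (sol p))) (fun p => 2 * absq (ip lam 0 i2 i1 (sol p))).
Proof.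
move=> p Dp; set G := fun m i j => ip lam m i j (sol p).
have absu : (fun q => absq (u q)) = (fun q => absq (ip lam 0 i0 i1 (sol q))).
  by apply/funext => q; exact: absq_u.
split; [|split].
- have uxx := @cD_u_twice i0 pux p Dp (ham_deriv_ux _).
  have uyy := @cD_u_twice i1 puy p Dp (ham_deriv_uy _).
  rewrite cD_u // uxx uyy.
  rewrite mulrA mulNr iC_sqr opprK mul1r ham_deriv_ut -/G.
  rewrite absq_u absqE [ofR (_ + _)]ofRD !ofRM !absqE !conjc_ip !ofR_nat /u -!/(G _ _ _).
  move: (ham_deriv _ _ _ _) (ham_deriv _ _ _ _) => d1 d2; ring.
- have v1x := derive_double_absq i0 i2 i0 Dp; have v1y := derive_double_absq i1 i2 i0 Dp.
  apply: ofR_inj; rewrite absu ofRB ofRN; apply: (etrans (congr2 (fun a b => a - b) v1x v1y)).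
  rewrite -mulrBr; apply: (etrans (ham_deriv_v1 _ _)); congr (- _).
  exact/esym/derive_absq.
- have v2x := derive_double_absq i0 i2 i1 Dp; have v2y := derive_double_absq i1 i2 i1 Dp.
  apply: ofR_inj; rewrite absu ofRD ofRN; apply: (etrans (congr2 (fun a b => a + b) v2x v2y)).
  rewrite -mulrDr; apply: (etrans (ham_deriv_v2 _ _)); congr (- _).
  exact/esym/derive_absq.
Qed.

End DaveyStewartson.
End IntegralsAndHamiltonians.

(** * Functional independence *)

Section Genericity.
Context {R : realType} {n : nat}.
Implicit Types (f g : PS R n -> R[i]) (x y h v : PS R n).

Lemma phi_line x h t j a : phi (x + t *: h) j a = phi x j a + ofR t * phi h j a.
Proof. by rewrite /phi !mxE; apply/eqP; rewrite eq_complex /= !mul0r subr0 addr0 !eqxx. Qed.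

Lemma polyfun_line f x h : polyfun f ->
  exists p : {poly R[i]}, forall t, f (x + t *: h) = p.[ofR t].
Proof.
elim=> [c|j a|j a|{}f g _ [p fp] _ [q gq]|{}f g _ [p fp] _ [q gq]].
- by exists c%:P => t; rewrite hornerC.
- exists ((phi x j a)%:P + (phi h j a)%:P * 'X) => t.
  by rewrite phi_line !hornerE mulrC.
- exists ((conjc (phi x j a))%:P + (conjc (phi h j a))%:P * 'X) => t.
  by rewrite phi_line conjcD conjcM conjc_ofR !hornerE mulrC.
- by exists (p + q) => t; rewrite hornerD fp gq.
- by exists (p * q) => t; rewrite hornerM fp gq.
Qed.

Lemma small_nonroot (p : {poly R[i]}) (e : R) : p != 0 -> 0 < e ->
  (* The points e/(k + 2), k < [size p], are distinct and lie strictly between 0 and e; they are too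
     many to be all roots. *)
  exists t, [/\ 0 < t, t < e & p.[ofR t] != 0].
Proof.
move=> p0 e0; pose z k : R := e / k.+2%:R.
have z_inj : injective (ofR \o z).
  by move=> k l /ofR_inj/(mulfI (lt0r_neq0 e0))/invr_inj/eqP; rewrite eqr_nat => /eqP[].
case: (boolP (all (root p) [seq (ofR \o z) k | k <- iota 0 (size p)])) => [rp|].
  by have := max_poly_roots p0 rp; rewrite map_inj_uniq // iota_uniq size_map size_iota ltnn => /(_ isT).
case/allPn => _ /mapP[k _ ->] nr; exists (z k); split => //.
- by rewrite divr_gt0.
- by rewrite ltr_pdivrMr // ltr_pMr // ltr1n.
Qed.

Lemma open_nonzero f : polyfun f -> open [set x | f x != 0].
Proof.
move=> pf.
have -> : [set x | f x != 0] =
    (fun x => reC (f x)) @^-1` [set r | r != 0] `|` (fun x => imC (f x)) @^-1` [set r | r != 0].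
  apply/seteqP; split => x /=; case: (f x) => a b /=; rewrite eq_complex /= negb_and; first by move=> /orP.
  by move=> ab; apply/orP.
have neq0 : open [set r : R | r != 0].
  by rewrite (_ : [set r : R | _] = [set r | r != 0]) //; exact: open_neq.
apply: openU; apply: open_comp => // x _; apply: differentiable_continuous.
- exact: (cdiff x pf).1.
- exact: (cdiff x pf).2.
Qed.

(** On the line from [x] to [y], [f] is a polynomial in the parameter with nonzero value at 1, so it
    is nonzero at points arbitrarily close to [x]. *)
Lemma dense_nonzero f y : polyfun f -> f y != 0 -> dense [set x | f x != 0].
Proof.
move=> pf fy O [x Ox] oO; have [p fp] := polyfun_line x (y - x) pf.
have p0 : p != 0.
  apply: contraNneq fy => p0; have := fp 1.
  by rewrite scale1r addrC subrK p0 horner0 => ->.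
have cg : {for 0, continuous (fun t : R => x + t *: (y - x))}.
  by apply: cvgD; [exact: cvg_cst | apply: cvgZr_tmp; exact: cvg_id].
have /nbhs_ballP[e /= e0 eO] : nbhs (0 : R) [set t | O (x + t *: (y - x))].
  by apply: cg; rewrite scale0r addr0; apply: open_nbhs_nbhs.
have [t [t0 te pt]] := small_nonroot p0 e0.
exists (x + t *: (y - x)); split; last by rewrite /= fp.
by apply: eO; rewrite /ball /= sub0r normrN gtr0_norm.
Qed.

(** Polynomials without terms of degree below [k]. The last constructor makes [k] a lower bound, so
    that terms of different orders can be added. *)
Inductive vanishing : nat -> (PS R n -> R[i]) -> Prop :=
| vanishing_cst c : vanishing 0 (fun=> c)
| vanishing_phi j a : vanishing 1 (fun x => phi x j a)
| vanishing_conj j a : vanishing 1 (fun x => conjc (phi x j a))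
| vanishingD k f g : vanishing k f -> vanishing k g -> vanishing k (fun x => f x + g x)
| vanishingM k l f g : vanishing k f -> vanishing l g -> vanishing (k + l) (fun x => f x * g x)
| vanishingS k f : vanishing k.+1 f -> vanishing k f.

Lemma vanishingW k l f : (k <= l)%N -> vanishing l f -> vanishing k f.
Proof.
move=> /subnK <-; elim: (l - k)%N => // d IH vf; apply: IH.
by apply: vanishingS; rewrite -addSn.
Qed.

Lemma vanishing0 k : vanishing k (fun=> 0).
Proof.
(* A constant generator has order 0 only, so zero is written as a [k]-th power of a coordinate times
   0. *)
rewrite -[k]addn0; have -> : (fun=> 0) = (fun x : PS R n => phi x i0 ord0 ^+ k * 0).
  by apply/funext => x; rewrite mulr0.
apply: vanishingM (vanishing_cst 0); elim: k => [|k IH]; first exact: vanishing_cst.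
have -> : (fun x => phi x i0 ord0 ^+ k.+1) = (fun x : PS R n => phi x i0 ord0 * phi x i0 ord0 ^+ k).
  by apply/funext => x; rewrite exprS.
by rewrite -add1n; apply: vanishingM => //; exact: vanishing_phi.
Qed.

Lemma vanishing_sum k (I : Type) (r : seq I) (F : I -> PS R n -> R[i]) :
  (forall i, vanishing k (F i)) -> vanishing k (fun x => \sum_(i <- r) F i x).
Proof.
move=> vF; elim: r => [|i r IH].
  have -> : (fun x => \sum_(i <- [::]) F i x) = fun=> 0.
    by apply/funext => x; rewrite big_nil.
  exact: vanishing0.
have -> : (fun x => \sum_(i <- i :: r) F i x) = (fun x => F i x + \sum_(i <- r) F i x).
  by apply/funext => x; rewrite big_cons.
exact: vanishingD.
Qed.

Lemma vanishing_polyfun k f : vanishing k f -> polyfun f.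
Proof.
elim=> //; [exact: polyfun_cst|exact: polyfun_phi|exact: polyfun_conj| |].
- by move=> *; exact: polyfunD.
- by move=> *; exact: polyfunM.
Qed.

Lemma vanishing_cD v k f : vanishing k f -> vanishing k.-1 (cD v f).
Proof.
elim=> {k f} [c|j a|j a|k f g vf IHf vg IHg|k l f g vf IHf vg IHg|k f vf IHf].
- have -> : cD v (fun=> c) = fun=> 0 by apply/funext => x; rewrite cD_cst.
  exact: vanishing_cst.
- have -> : cD v (fun x => phi x j a) = fun=> Complex (v (reI j) a) (v (imI j) a).
    by apply/funext => x; rewrite cD_phi_id.
  exact: vanishing_cst.
- have -> : cD v (fun x => conjc (phi x j a)) = fun=> conjc (Complex (v (reI j) a) (v (imI j) a)).
    by apply/funext => x; rewrite cD_conj_id.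
  exact: vanishing_cst.
- have -> : cD v (fun x => f x + g x) = fun x => cD v f x + cD v g x.
    by apply/funext => x; rewrite cDD //; apply: cdiff; [exact: vanishing_polyfun vf | exact: vanishing_polyfun vg].
  exact: vanishingD.
- have -> : cD v (fun x => f x * g x) = fun x => cD v f x * g x + f x * cD v g x.
    by apply/funext => x; rewrite cDM //; apply: cdiff; [exact: vanishing_polyfun vf | exact: vanishing_polyfun vg].
  apply: vanishingD.
    apply: (@vanishingW _ (k.-1 + l)); last by apply: vanishingM.
    by case: (k) => [|k'] //=; exact: leq_pred.
  apply: (@vanishingW _ (k + l.-1)); last by apply: vanishingM.
  by case: (l) => [|l']; rewrite ?addn0 ?leq_pred // addnS.
- by case: k vf IHf => [|k] _ IHf //; exact: vanishingS.
Qed.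

Lemma vanishing_ray k f y : vanishing k f ->
  exists p : {poly R[i]}, forall t, f (t *: y) = ofR t ^+ k * p.[ofR t].
Proof.
have phiZ t j a : phi (t *: y) j a = ofR t * phi y j a.
  have phi0 : phi (0 : PS R n) j a = 0 by rewrite /phi !mxE.
  by rewrite -[t *: y]add0r phi_line phi0 add0r.
elim=> {k f} [c|j a|j a|k f g _ [p fp] _ [q gq]|k l f g _ [p fp] _ [q gq]|k f _ [p fp]].
- by exists c%:P => t; rewrite hornerC mul1r.
- by exists (phi y j a)%:P => t; rewrite hornerC phiZ.
- by exists (conjc (phi y j a))%:P => t; rewrite hornerC phiZ conjcM conjc_ofR.
- by exists (p + q) => t; rewrite hornerD fp gq mulrDr.
- by exists (p * q) => t; rewrite hornerM fp gq exprD mulrACA.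
- by exists ('X * p) => t; rewrite hornerM hornerX fp exprSr mulrA.
Qed.

End Genericity.

(** * Expansion of the integrals at the origin *)

Section LeadingTerms.
Context {R : realType} {n : nat} (lam : 'I_n.+1 -> R).
Implicit Types (x y : PS R n).

Definition laxpart M x (p : 'I_3 * 'I_3) : {poly R[i]} :=
  \sum_(a < n.+1) (\sum_(k < M) 'X^(k.+1) * (ofR (lam a ^+ k))%:P) * (FF x a p.1 p.2)%:P.

Lemma vanishing_laxpart M p s : vanishing 2 (fun x => (laxpart M x p)`_s).
Proof.
have -> : (fun x => (laxpart M x p)`_s) = fun x => \sum_(a < n.+1)
    (\sum_(k < M) 'X^(k.+1) * (ofR (lam a ^+ k))%:P)`_s * (phi x p.1 a * conjc (phi x p.2 a)).
  by apply/funext => x; rewrite coef_sum; apply: eq_bigr => a _; rewrite coefMC mxE.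
apply: vanishing_sum => a.
exact: (vanishingM (vanishing_cst _) (vanishingM (vanishing_phi _ _) (vanishing_conj _ _))).
Qed.

Lemma laxpart_coef m x p : (laxpart m.+1 x p)`_m.+1 = ip lam m p.2 p.1 x.
Proof.
rewrite coef_sum; apply: eq_bigr => a _; rewrite coefMC coef_sum big_ord_recr /= big1 => [|k _].
  by rewrite add0r coefMC coefXn eqxx mul1r mxE -mulrA [phi _ _ _ * _]mulrC.
by rewrite coefMC coefXn eqSS gtn_eqF ?ltn_ord // mul0r.
Qed.

(** A lower bound for the degree in the variables. The entries of [laxpart] are quadratic in the
    coordinates, which doubles it in [vanishing_peval]. *)
Fixpoint pexpr_ord (K X : Type) (e : pexpr X K) : nat :=
  match e with
  | PVar _ => 1
  | PCst _ => 0
  | PAdd e1 e2 => minn (pexpr_ord e1) (pexpr_ord e2)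
  | PMul e1 e2 => pexpr_ord e1 + pexpr_ord e2
  end.

Lemma vanishing_peval M (e : pexpr ('I_3 * 'I_3) {poly R[i]}) s :
  vanishing (pexpr_ord e).*2 (fun x => (peval (laxpart M x) e)`_s).
Proof.
elim: e s => [p|c|e1 IH1 e2 IH2|e1 IH1 e2 IH2] s /=.
- exact: vanishing_laxpart.
- exact: vanishing_cst.
- have -> : (fun x => (peval (laxpart M x) e1 + peval (laxpart M x) e2)`_s) =
      fun x => (peval (laxpart M x) e1)`_s + (peval (laxpart M x) e2)`_s.
    by apply/funext => x; rewrite coefD.
  apply: vanishingD; [apply: vanishingW (IH1 s)|apply: vanishingW (IH2 s)];
    rewrite leq_double; [exact: geq_minl|exact: geq_minr].
- have -> : (fun x => (peval (laxpart M x) e1 * peval (laxpart M x) e2)`_s) =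
      fun x => \sum_(i < s.+1) (peval (laxpart M x) e1)`_i * (peval (laxpart M x) e2)`_(s - i).
    by apply/funext => x; rewrite coefM.
  by apply: vanishing_sum => i; rewrite doubleD; apply: vanishingM.
Qed.

(* Row [k] holds the coefficients of [<Phi_j, Lam^m Phi_j>] in the linear part of [E_m^(k+1)]. *)
Definition lincoef (k j : nat) : R[i] :=
  match k, j with
  | 0, _ => 1
  | 1, 0 => -1
  | 1, 1 => 1
  | 2, 2 => -1
  | _, _ => 0
  end.

(** The 3x3 matrix [lincoef] has determinant -2; its columns force [w0 = w1], [w0 = - w1] and
    [w0 = w2]. *)
Lemma lincoef_free (w : 'I_3 -> R[i]) :
  (forall j : 'I_3, \sum_(k < 3) w k * lincoef k j = 0) -> forall k, w k = 0.
Proof.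
move=> wA; have := wA i0; have := wA i1; have := wA i2; rewrite !big_ord_recl !big_ord0 /=.
set w0 := w _; set w1 := w _; set w2 := w _.
rewrite !(mulr1, mulr0, addr0, add0r, mulrN1) => /subr0_eq w02 w01 /subr0_eq w01'.
have w00 : w0 = 0.
  by apply/eqP; move: w01; rewrite -w01' -mulr2n => /eqP; rewrite mulrn_eq0.
case=> -[|[|[|//]]] kl; [rewrite -w00 | rewrite -w00 w01' | rewrite -w00 w02];
  by congr w; apply/val_inj.
Qed.

(** The terms of degree at least 2 in g of [charcoef k] at C + g. The trace has none, but its zero
    is written as a multiple of a quadratic term, so that [pexpr_ord] returns 2. *)
Definition charcoef_rest (k : nat) : pexpr ('I_3 * 'I_3) {poly R[i]} :=
  match k with
  | 0 => PMul (PCst 0) (PMul (pent i0 i0) (pent i0 i0))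
  | 1 => charcoef 1
  | _ => PAdd (psub (minor2 i1 i2) (minor2 i0 i2)) (charcoef 2)
  end.

Lemma charcoef_shift (g : 'I_3 * 'I_3 -> {poly R[i]}) (k : 'I_3) : exists c : R[i],
  peval (fun p => (Centry p)%:P + g p) (charcoef k) =
  c%:P + \sum_(j < 3) (lincoef k j)%:P * g (j, j) + peval g (charcoef_rest k).
Proof.
rewrite !big_ord_recl big_ord0.
have -> : ord0 = i0 by apply/val_inj.
have -> : lift i0 ord0 = i1 by apply/val_inj.
have -> : lift i0 (lift ord0 ord0) = i2 by apply/val_inj.
case: k => -[|[|[|//]]] /= _; rewrite /Centry /=.
- by exists 0; ring.
- by exists (-1); ring.
- by exists 0; ring.
Qed.

Lemma E_leading (k : 'I_3) m : exists2 r, vanishing 4 r & forall x,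
  E lam k m x = \sum_(j < 3) lincoef k j * ip lam m j j x + r x.
Proof.
exists (fun x => (peval (laxpart m.+1 x) (charcoef_rest k))`_m.+1).
  apply: vanishingW (vanishing_peval _ _ _).
  by case: k => -[|[|[|//]]].
move=> x; rewrite /E /pk charcoefE.
have [c cE] := charcoef_shift (laxpart m.+1 x) k.
rewrite (_ : mxent _ = fun p => (Centry p)%:P + laxpart m.+1 x p); last first.
  by apply/funext => p; rewrite Ltrunc_ent CmatE.
(* The constant [c] does not contribute, since the coefficient taken has positive index. *)
rewrite cE !coefD coefC add0r; congr (_ + _); rewrite coef_sum.
by apply: eq_bigr => j _; rewrite coefCM laxpart_coef.
Qed.

Definition onespt : PS R n := \matrix_(c, a) (c < 3)%N%:R.

Lemma phi_onespt t j a : phi (t *: onespt) j a = ofR t.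
Proof.
rewrite /phi !mxE /= ltn_ord mulr1.
by rewrite mulr0.
Qed.

Lemma cD_sum (v : PS R n) (I : Type) (r : seq I) (F : I -> PS R n -> R[i]) x :
  (forall i, polyfun (F i)) ->
  cD v (fun y => \sum_(i <- r) F i y) x = \sum_(i <- r) cD v (F i) x.
Proof.
move=> pF; elim: r => [|i r IH].
  have -> : (fun y => \sum_(i <- [::]) F i y) = fun=> 0.
    by apply/funext => y; rewrite big_nil.
  by rewrite cD_cst big_nil.
have -> : (fun y => \sum_(j <- i :: r) F j y) = (fun y => F i y + \sum_(j <- r) F j y).
  by apply/funext => y; rewrite big_cons.
rewrite cDD ?IH ?big_cons //; apply: cdiff => //; exact: polyfun_sum.
Qed.

Lemma dRe_ip_onespt m i j a t :
  dRe (ip lam m i i) j a (t *: onespt) = (i == j)%:R * (2 * ofR (lam a ^+ m) * ofR t).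
Proof.
have pp b : polyfun (fun y => ofR (lam b ^+ m) * (conjc (phi y i b) * phi y i b)).
  by apply: polyfunM; [exact: polyfun_cst | exact: polyfun_pair].
rewrite ip_wip /dRe cD_sum //.
have pairE b : cD (delta_mx (reI j) a) (fun y : PS R n =>
    ofR (lam b ^+ m) * (conjc (phi y i b) * phi y i b)) (t *: onespt) =
    ((i == j) && (b == a))%:R * (2 * ofR (lam b ^+ m) * ofR t).
  rewrite cDM; [|exact: cdifferentiable_cst|by apply: cdiff; exact: polyfun_pair].
  rewrite cD_cst mul0r add0r cDM; [|by apply: cdiff; exact: polyfun_conj|by apply: cdiff; exact: polyfun_phi].
  rewrite -/(dRe _ j a _) -/(dRe _ j a _) dRe_conj dRe_phi !phi_onespt conjc_ofR.
  by move: (ofR _) (ofR t) (_%:R) => u w d; ring.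
rewrite (bigD1 a) //= pairE eqxx andbT big1 ?addr0 // => b ba.
by rewrite pairE (negbTE ba) andbF mul0r.
Qed.

Lemma dRe_E_onespt (k j : 'I_3) m a : exists q : {poly R[i]}, forall t,
  dRe (E lam k m) j a (t *: onespt) =
  ofR t * (2 * lincoef k j * ofR (lam a) ^+ m + ofR t * q.[ofR t]).
Proof.
have [r vr EE] := E_leading k m.
have [p pE] := vanishing_ray onespt (vanishing_cD (delta_mx (reI j) a) vr).
(* The derivative of the remainder has order 3; one factor t goes outside, one precedes [q], and the
   third is this ['X]. *)
exists ('X * p) => t.
have pl (i : 'I_3) : polyfun (fun x => lincoef k i * ip lam m i i x).
  by apply: polyfunM; [exact: polyfun_cst | exact: polyfun_ip].
rewrite (funext EE) /dRe cDD; [|by apply: cdiff; exact: polyfun_sum|by apply: cdiff; exact: vanishing_polyfun vr].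
rewrite pE /= cD_sum // (bigD1 j) //= big1 => [|i ij]; last first.
  rewrite cDM; [|exact: cdifferentiable_cst|by apply: cdiff; exact: polyfun_ip].
  by rewrite cD_cst mul0r add0r -/(dRe _ j a _) dRe_ip_onespt (negbTE ij) mul0r mulr0.
rewrite cDM; [|exact: cdifferentiable_cst|by apply: cdiff; exact: polyfun_ip].
rewrite cD_cst mul0r add0r -/(dRe _ j a _) dRe_ip_onespt eqxx mul1r addr0 ofRX hornerM hornerX.
by move: (ofR t) p.[_] (ofR (lam a)) (lincoef k j) => u v w l; ring.
Qed.

End LeadingTerms.

(** * A nonvanishing minor of the Jacobian *)

Section Independence.
Context {R : realType} {n : nat} (lam : 'I_n.+1 -> R).
Hypothesis lam_inj : injective lam.

Notation size_ := (3 * n.+1)%N.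

(** [blk] and [pos] decode a row number as [Jac] does; the same code numbers the columns of the
    minor. *)
Definition blk (r : 'I_size_) : 'I_3 := inord (r %/ n.+1).
Definition pos (r : 'I_size_) : 'I_n.+1 := inord (r %% n.+1).

Lemma blkE r : blk r = (r %/ n.+1)%N :> nat.
Proof. by rewrite inordK // ltn_divLR. Qed.

Lemma posE r : pos r = (r %% n.+1)%N :> nat.
Proof. by rewrite inordK // ltn_mod. Qed.

Lemma pair_subproof (k : 'I_3) (a : 'I_n.+1) : (k * n.+1 + a < size_)%N.
Proof.
by rewrite (@leq_trans (k.+1 * n.+1)) ?leq_mul2r ?ltn_ord ?orbT // mulSnr ltn_add2l.
Qed.

Definition pairidx k a := Ordinal (pair_subproof k a).

Lemma blk_pairidx k a : blk (pairidx k a) = k.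
Proof. by apply/ord_inj; rewrite blkE /= divnMDl // divn_small ?addn0. Qed.

Lemma pos_pairidx k a : pos (pairidx k a) = a.
Proof. by apply/ord_inj; rewrite posE /= modnMDl modn_small. Qed.

Lemma pairidxK r : pairidx (blk r) (pos r) = r.
Proof. by apply/ord_inj; rewrite [RHS](divn_eq r n.+1) -blkE -posE. Qed.

Definition leading : 'M[R[i]]_size_ :=
  \matrix_(r, s) (2 * lincoef (blk r) (blk s) * ofR (lam (pos s)) ^+ (pos r)).

(** A vector in the left kernel yields for each [j] a polynomial [P j] of size at most N with the N
    distinct roots [lam a]. So all its coefficients vanish, and [lincoef_free] applies at each
    power. *)
Lemma leading_unit : leading \in unitmx.
Proof.
rewrite -row_free_unit; apply: inj_row_free => v vK0.
pose P (j : 'I_3) := \poly_(m < n.+1) \sum_(k < 3) v 0 (pairidx k (inord m)) * lincoef k j.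
have Proot j a : root (P j) (ofR (lam a)).
  have /rowP/(_ (pairidx j a)) := vK0; rewrite !mxE => vr.
  have two0 : 2 != 0 :> R[i] by rewrite pnatr_eq0.
  apply/eqP/(mulfI two0); rewrite mulr0 -[RHS]vr horner_poly mulr_sumr.
  rewrite (reindex (fun p : 'I_3 * 'I_n.+1 => pairidx p.1 p.2)) /=; last first.
    exists (fun r => (blk r, pos r)) => [[k b] _|r _]; last exact: pairidxK.
    by rewrite blk_pairidx pos_pairidx.
  rewrite -(pair_bigA _ (fun k b => v 0 (pairidx k b) * leading (pairidx k b) (pairidx j a))) /=.
  rewrite exchange_big; apply: eq_bigr => b _; rewrite inord_val mulr_suml mulr_sumr.
  apply: eq_bigr => k _; rewrite mxE !blk_pairidx !pos_pairidx.
  by move: (v _ _) (lincoef _ _) (_ ^+ _) => x y z; ring.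
have P0 j : P j = 0.
  apply/eqP; apply: contraT => Pn0.
  have roots : all (root (P j)) [seq ofR (lam a) | a <- enum 'I_n.+1].
    by apply/allP => _ /mapP[a _ ->].
  have := max_poly_roots Pn0 roots.
  rewrite map_inj_uniq ?enum_uniq; last by move=> a b /ofR_inj/lam_inj.
  by rewrite size_map size_enum_ord ltnNge size_poly => /(_ isT).
apply/rowP => r; rewrite mxE -(pairidxK r).
apply: (lincoef_free (w := fun k => v 0 (pairidx k (pos r)))) => j.
have := congr1 (fun p : {poly R[i]} => p`_(pos r)) (P0 j).
by rewrite coef0 coef_poly ltn_ord inord_val.
Qed.

Definition jacminor (x : PS R n) : 'M[R[i]]_size_ :=
  \matrix_(r, s) dRe (E lam (blk r) (pos r)) (blk s) (pos s) x.

Lemma rank_Jac x : \det (jacminor x) != 0 -> \rank (Jac lam x) = size_.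
Proof.
move=> dx; apply/eqP; apply: inj_row_free => v vJ.
have mu : jacminor x \in unitmx by rewrite unitmxE unitfE.
suff vm : v *m jacminor x = 0 by rewrite -[v](mulmxK mu) vm mul0mx.
apply/rowP => s; rewrite !mxE.
(* This column of [Jac] is the column [s] of the minor. *)
have /rowP/(_ (mxvec_index (reI (blk s)) (pos s))) := vJ; rewrite !mxE => vJs.
rewrite -[RHS]vJs; apply: eq_bigr => r _; congr (_ * _).
by rewrite !mxE mxvecE mxE posE.
Qed.

Lemma polyfun_jacminor r s : polyfun (fun x => jacminor x r s).
Proof.
have -> : (fun x => jacminor x r s) = dRe (E lam (blk r) (pos r)) (blk s) (pos s).
  by apply/funext => x; rewrite mxE.
exact: polyfun_cD (polyfun_E _ _ _).
Qed.

Lemma polyfun_det_jacminor : polyfun (fun x => \det (jacminor x)).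
Proof.
apply: polyfun_sum => s; apply: polyfunM; first exact: polyfun_cst.
by apply: polyfun_prod => r; exact: polyfun_jacminor.
Qed.

(** Along the ray the minor is t ([leading] + t Q(t)) with Q polynomial in t. The determinant of the
    bracket is a polynomial whose value at 0 is that of [leading], so it is nonzero for some
    positive t. *)
Lemma jacminor_nondegenerate : exists x, \det (jacminor x) != 0.
Proof.
have /boolp.choice[q qE] : forall rs : 'I_size_ * 'I_size_, exists q : {poly R[i]}, forall t,
    jacminor (t *: onespt) rs.1 rs.2 = ofR t * (leading rs.1 rs.2 + ofR t * q.[ofR t]).
  move=> [r s]; have [q qE] := dRe_E_onespt lam (blk r) (blk s) (pos r) (pos s).
  by exists q => t; rewrite !mxE qE.
pose M : 'M[{poly R[i]}]_size_ := \matrix_(r, s) ((leading r s)%:P + 'X * q (r, s)).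
have Mt t : jacminor (t *: onespt) = ofR t *: map_mx (horner_eval (ofR t)) M.
  by apply/matrixP => r s; rewrite (qE (r, s)) !mxE /horner_eval !hornerE.
have M0 : map_mx (horner_eval 0) M = leading.
  by apply/matrixP => r s; rewrite !mxE /horner_eval !hornerE.
have dM : \det M != 0.
  apply: contraTneq leading_unit => dM.
  by rewrite unitmxE -M0 det_map_mx dM rmorph0 unitr0.
have [t [t0 _ tM]] := small_nonroot dM ltr01.
exists (t *: onespt); rewrite Mt detZ det_map_mx mulf_neq0 //.
by rewrite expf_neq0 // ofR_eq0 gt_eqF.
Qed.

End Independence.

(* N = n.+1 >= 1; lam = (lambda_1, ..., lambda_N) distinct and nonzero. *)
Theorem theorem1 (R : realType) (n : nat) (lam : 'I_n.+1 -> R)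
  (lam_inj : injective lam) (lam_nz : forall a, lam a != 0) :
  (* H^x, H^y, H^t pairwise Poisson-commute *)
  [/\ poisson_commute (Hx lam) (Hy lam),
      poisson_commute (Hx lam) (Ht lam) &
      poisson_commute (Hy lam) (Ht lam)]
  (* the E_m^{(k)} (k = 1,2,3; m = 0..N-1) commute pairwise and with H^x,H^y,H^t *)
  /\ (forall (k k' : 'I_3) (m m' : nat), (m < n.+1)%N -> (m' < n.+1)%N ->
        poisson_commute (E lam k m) (E lam k' m'))
  /\ (forall (k : 'I_3) (m : nat), (m < n.+1)%N ->
        [/\ poisson_commute (E lam k m) (Hx lam),
            poisson_commute (E lam k m) (Hy lam) &
            poisson_commute (E lam k m) (Ht lam)])
  (* functional independence on a dense open subset of R^{6N} *)
  /\ (exists S : set (PS R n),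
        open S /\ dense S /\ forall x, S x -> \rank (Jac lam x) = (3 * n.+1)%N)
  (* simultaneous smooth solutions (on an open domain D of R^3 = (x,y,t))
     give solutions of DS-I on D *)
  /\ (forall (D : set 'rV[R]_3) (sol : 'rV[R]_3 -> PS R n), open D ->
        smooth3 D sol -> ham_solution lam D sol ->
        DSI D (fun p => iC * ip lam 0 i1 i0 (sol p))
            (fun p => 2 * absq (ip lam 0 i2 i0 (sol p)))
            (fun p => 2 * absq (ip lam 0 i2 i1 (sol p)))).
Proof.
split; first by split; [exact: (Hs_involution lam i0 i1) | exact: (Hs_involution lam i0 i2)
  | exact: (Hs_involution lam i1 i2)].
split; first by move=> k k' m m' _ _; exact: E_involution.
split.
  by move=> k m _; split; [exact: (E_Hs_commute lam k i0 m) | exact: (E_Hs_commute lam k i1 m)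
    | exact: (E_Hs_commute lam k i2 m)].
split; last by move=> D sol; exact: DSI_solution.
have [y dy] := jacminor_nondegenerate lam_inj.
have pd := polyfun_det_jacminor lam.
exists [set x | \det (jacminor lam x) != 0]; split; first exact: open_nonzero.
by split; [exact: (dense_nonzero pd dy) | exact: rank_Jac].
Qed.
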